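(* Let $B=(B_t)_{t\ge 0}$ be a real-valued standard Brownian motion with $B_0=0$, and for $x\in\mathbb R$ let $\mathcal Z_x=\{t\ge0: B_t=x\}$. Almost surely, for all $x\in\mathbb R$, $\mathrm{Dim}_\mathrm{H}(\mathcal Z_x)=\tfrac12$.
   Context: Notation: $|A|$ is Lebesgue measure (length of an interval). Let $\mathcal S_n=[2^{n-1},2^n)$ for $n\ge1$. For $E\subset\mathbb R^+$, $\rho\ge0$ and $n\ge1$, let $$\nu^n_\rho(E)=\inf\Big\{\sum_{i=1}^m\Big(\frac{|Q_i|}{2^n}\Big)^\rho: Q_i\subset\mathcal S_n \text{ non-trivial intervals with integer endpoints},\ E\cap\mathcal S_n\subset\bigcup_{i=1}^m Q_i\Big\},$$ the infimum being over finite families. The macroscopic Hausdorff dimension is $\mathrm{Dim}_\mathrm{H}E=\inf\{\rho\ge0:\sum_{n\ge1}\nu^n_\rho(E)<\infty\}$. *)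

(* Defs.v *)
From HB Require Import structures.
From mathcomp Require Import all_boot all_order all_algebra.
From mathcomp Require Import all_classical all_reals all_analysis.
Set Implicit Arguments. Unset Strict Implicit. Unset Printing Implicit Defensive.
Import Order.TTheory GRing.Theory Num.Theory.
Import numFieldNormedType.Exports.
Local Open Scope classical_set_scope.
Local Open Scope ring_scope.

Section BM.
Context {R : realType} {d : measure_display} {T : measurableType d}.
Variable (P : probability T R).

Definition incr (B : R -> T -> R) (s t : R) : T -> R := fun w => B t w - B s w.

(** Standard (one-dimensional) Brownian motion started at 0, indexed by t >= 0:
    - each B t (t >= 0) is a real random variable (measurable);
    - almost surely B 0 = 0 and t |-> B t is continuous on [0, +oo);
    - for 0 <= s < t, B t - B s has law N(0, t - s)
      (normal_prob m sigma has mean m and standard deviation sigma);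
    - independent increments: for 0 <= t_0 < t_1 < ... < t_n the increments
      B t_(i+1) - B t_i (i < n) are mutually independent. *)
Definition standard_BM (B : R -> T -> R) : Prop :=
  [/\ (forall t, 0 <= t -> measurable_fun setT (B t)),
      {ae P, forall w, B 0 w = 0 /\
                       {within [set t | 0 <= t], continuous (fun t => B t w)}},
      (forall s t, 0 <= s -> s < t -> forall A : set R, measurable A ->
         P (incr B s t @^-1` A) = normal_prob 0 (Num.sqrt (t - s)) A) &
      (forall (n : nat) (ts : nat -> R), 0 <= ts 0%N ->
         (forall i, (i < n)%N -> ts i < ts i.+1) ->
         forall A : nat -> set R, (forall i, measurable (A i)) ->
         P (\bigcap_(i in `I_n) (incr B (ts i) (ts i.+1) @^-1` A i)) =
         (\prod_(i < n) fine (P (incr B (ts i) (ts i.+1) @^-1` A i)))%:E)].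

Definition level_set (B : R -> T -> R) (w : T) (x : R) : set R :=
  [set t | 0 <= t /\ B t w = x].

End BM.

Section MacroDim.
Context {R : realType}.

Definition dyadic_shell (n : nat) : set R :=
  [set x | 2 ^+ n.-1 <= x /\ x < 2 ^+ n].

(** an interval with integer endpoints a, b; q = ((a, b), (lb, rb)), where
    the booleans encode whether each endpoint is included (all four kinds
    of intervals: [a,b], [a,b), (a,b], (a,b)). *)
Definition int_interval (q : (int * int) * (bool * bool)) : set R :=
  [set` Interval (BSide q.2.1 (q.1.1)%:~R) (BSide (~~ q.2.2) (q.1.2)%:~R)].

Definition admissible (n : nat) (q : (int * int) * (bool * bool)) : Prop :=
  (q.1.1 < q.1.2)%R /\ int_interval q `<=` dyadic_shell n.

Definition cover_cost (n : nat) (rho : R) (Q : seq ((int * int) * (bool * bool))) : R :=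
  \sum_(q <- Q) powR ((q.1.2 - q.1.1)%:~R / 2 ^+ n) rho.

Definition nu (n : nat) (rho : R) (E : set R) : R :=
  inf [set c | exists Q : seq ((int * int) * (bool * bool)),
         (forall q, q \in Q -> admissible n q) /\
         (E `&` dyadic_shell n `<=` [set x | exists2 q, q \in Q & int_interval q x]) /\
         c = cover_cost n rho Q].

Definition macro_dimH (E : set R) : R :=
  inf [set rho | 0 <= rho /\
         (\sum_(1 <= n <oo) (nu n rho E)%:E < +oo)%E].

End MacroDim.

(* Main.v *)
Require Import Defs.
From HB Require Import structures.
From mathcomp Require Import all_boot all_order all_algebra.
From mathcomp Require Import all_classical all_reals all_analysis.
From mathcomp Require Import measurable_realfun ring lra zify.
Set Implicit Arguments. Unset Strict Implicit. Unset Printing Implicit Defensive.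
Import Order.TTheory GRing.Theory Num.Theory.
Import numFieldNormedType.Exports.
Local Open Scope classical_set_scope.
Local Open Scope ring_scope.

(** Upper bound.  Chaining over dyadic increments shows that almost surely, for
    large n, the path oscillates by O(n) on every unit interval of the shell
    S_n.  So a unit interval [k, k+1) meeting Z_x has |B_k| = O(n), and by
    Markov's inequality and Borel-Cantelli there are at most 2^(n(1/2+eps))
    such k; they cover Z_x in S_n.

    Lower bound.  Fix an integer j, rho < 1/2 and n = 2m.  A time k of S_n is a
    crossing if the path goes from below j to above j+1 during [k, k+1]; then
    every level x in [j, j+1] is hit there.  For the set S of crossing times
    and the Riesz kernel K of exponent rho at scale 2^n, completing the square
    on each covering interval bounds 2 lam |S| - lam^2 sum_(k,l in S) K(k,l) by
    twice the cost of any cover, uniformly in x.  This quantity is at most 1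
    and, for lam of order 2^-m, its expectation given the path up to a time
    s <= 2^(n-2) with |B_s| <= 2^m is bounded below; so with conditional
    probability at least eta it is at least eta.  Along n_k = 2 (k+1)^2 the
    shells are separated enough for this to happen almost surely infinitely
    often, and then nu^n(Z_x) does not tend to 0. *)

(** * Gaussian estimates *)

Section gaussian.
Context {R : realType}.
Implicit Types s a b x m : R.
Local Notation mu := (@lebesgue_measure R).

Let pdfE m s x : 0 < s ->
  normal_pdf m s x = normal_peak s * expR (- (x - m) ^+ 2 / (s ^+ 2 *+ 2)).
Proof. by move=> s0; rewrite normal_pdfE ?gt_eqF. Qed.

(* Chernoff's bound on densities: tilting N(0, s^2) by a/s gives N(as, s^2). *)
Lemma normal_pdf_tilt a s x : 0 < s -> 0 <= a -> a * s <= `|x| ->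
  normal_pdf 0 s x <= expR (- (a ^+ 2 / 2)) *
    (normal_pdf (a * s) s x + normal_pdf (- (a * s)) s x).
Proof.
move=> s0 a0 ax.
have key m : m ^+ 2 = (a * s) ^+ 2 -> (a * s) ^+ 2 <= x * m ->
    normal_pdf 0 s x <= expR (- (a ^+ 2 / 2)) * normal_pdf m s x.
  move=> m2 xm; rewrite !pdfE// mulrCA ler_wpM2l ?normal_peak_ge0//.
  rewrite -expRD ler_expR subr0.
  rewrite [leRHS](_ : _ = (- (a * s) ^+ 2 - (x - m) ^+ 2) / (s ^+ 2 *+ 2)); last first.
    by field; rewrite gt_eqF.
  rewrite ler_wpM2r ?invr_ge0 ?mulrn_wge0 ?sqr_ge0//.
  rewrite sqrrB m2; nra.
have [x0|x0] := leP 0 x.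
- rewrite (le_trans (key (a * s) _ _)) ?ler_wpM2l ?expR_ge0 ?lerDl ?normal_pdf_ge0//.
  by rewrite expr2 ler_wpM2r ?mulr_ge0 ?(ltW s0)// (le_trans ax)// ger0_norm.
- rewrite (le_trans (key (- (a * s)) _ _)) ?ler_wpM2l ?expR_ge0 ?lerDr ?normal_pdf_ge0//.
    by rewrite sqrrN.
  rewrite ltr0_norm// in ax.
  have := mulr_ge0 a0 (ltW s0); nra.
Qed.

Lemma measurable_tail (t : R) : measurable [set x : R | t <= `|x|].
Proof.
rewrite (_ : [set x | _] = [set x | cst t x <= Num.norm x])//.
rewrite -[X in measurable X]setTI; apply: measurable_fun_le => //.
Qed.

(** Integrate [normal_pdf_tilt]: each of the two shifted densities has total mass one, whence the
    factor 2. *)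
Lemma normal_tail a s : 0 < s -> 0 <= a ->
  (normal_prob 0 s [set x : R | (a * s <= `|x|)%R] <= (2 * expR (- (a ^+ 2 / 2)))%:E)%E.
Proof.
move=> s0 a0; rewrite /normal_prob.
have s0' : s != 0 by rewrite gt_eqF.
have mp m D : measurable D -> measurable_fun D (EFin \o normal_pdf m s).
  move=> mD; apply/measurable_EFinP.
  apply: (measurable_funS measurableT) => //; exact: measurable_normal_pdf.
apply: (@le_trans _ _ (\int[mu]_x (expR (- (a ^+ 2 / 2)) *
    (normal_pdf (a * s) s x + normal_pdf (- (a * s)) s x))%:E)%E).
  apply: (@le_trans _ _ (\int[mu]_(x in [set x | (a * s <= `|x|)%R]) (expR (- (a ^+ 2 / 2)) *
    (normal_pdf (a * s) s x + normal_pdf (- (a * s)) s x))%:E)%E).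
    apply: ge0_le_integral => //.
    - exact: measurable_tail.
    - by move=> x _; rewrite lee_fin normal_pdf_ge0.
    - by apply: mp; exact: measurable_tail.
    - apply/measurable_EFinP; apply: measurable_funM => //.
      apply: (measurable_funS measurableT) => //.
      by apply: measurable_funD; exact: measurable_normal_pdf.
    - by move=> x ax; rewrite lee_fin; exact: normal_pdf_tilt.
  apply: ge0_subset_integral => //.
  - exact: measurable_tail.
  - apply/measurable_EFinP; apply: measurable_funM => //.
    by apply: measurable_funD; exact: measurable_normal_pdf.
  - by move=> x _; rewrite lee_fin mulr_ge0 ?expR_ge0// addr_ge0 ?normal_pdf_ge0.
have mD : measurable_fun [set: R] ((EFin \o normal_pdf (a * s) s) \+ (EFin \o normal_pdf (- (a * s)) s))%E.
  by apply: emeasurable_funD; apply: mp.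
under eq_integral do rewrite EFinM EFinD.
rewrite (@ge0_integralZl _ _ _ mu _ measurableT _ mD)//; last first.
  by move=> x _; rewrite /= -EFinD lee_fin addr_ge0 ?normal_pdf_ge0.
rewrite ge0_integralD//; [|by move=> x _; rewrite lee_fin normal_pdf_ge0|exact: mp
  |by move=> x _; rewrite lee_fin normal_pdf_ge0|exact: mp].
by rewrite !integral_normal_pdf// -EFinD -EFinM lee_fin mulrC.
Qed.

Let mu_itv a b : a <= b -> mu `[a, b] = (b - a)%:E.
Proof.
move=> ab; rewrite lebesgue_measure_itv/= lte_fin.
by case: ltgtP ab => // -> _; rewrite subrr.
Qed.

Lemma normal_prob_itv_le s a b : 0 < s -> a <= b ->
  (normal_prob 0 s `[a, b] <= ((b - a) / s)%:E)%E.
Proof.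
move=> s0 ab; rewrite /normal_prob.
apply: (@le_trans _ _ (\int[mu]_(x in `[a, b]) (cst (s^-1)%:E x))%E).
  apply: ge0_le_integral => //.
  - by move=> x _; rewrite lee_fin normal_pdf_ge0.
  - apply/measurable_EFinP; apply: (measurable_funS measurableT) => //.
    exact: measurable_normal_pdf.
  - move=> x _; rewrite lee_fin.
    rewrite (le_trans (normal_pdf_ub _ _ _)) ?gt_eqF//.
    rewrite /normal_peak lef_pV2 ?posrE//; last first.
      by rewrite sqrtr_gt0 mulrn_wgt0// mulr_gt0 ?pi_gt0// exprn_gt0.
    rewrite -[leLHS]gtr0_norm// -sqrtr_sqr ler_wsqrtr//.
    have := pi_ge2 R; have := exprn_gt0 2 s0; nra.
by rewrite integral_cst// [X in (_ * X)%E]mu_itv// -EFinM lee_fin mulrC.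
Qed.

(** On the interval the exponential factor is at least [expR (- (M ^+ 2 / 2))], and the peak is at
    least [1 / (3 s)] because [2 pi < 9]. *)
Lemma normal_prob_itv_ge s a b M : 0 < s -> a <= b ->
  (forall x, a <= x <= b -> `|x| <= M * s) ->
  (((b - a) / s * (expR (- (M ^+ 2 / 2)) / 3))%:E <= normal_prob 0 s `[a, b])%E.
Proof.
move=> s0 ab hM; rewrite /normal_prob.
apply: (@le_trans _ _ (\int[mu]_(x in `[a, b]) (cst (s^-1 * (expR (- (M ^+ 2 / 2)) / 3))%:E x))%E).
  rewrite integral_cst// [X in (_ * X)%E]mu_itv// -EFinM lee_fin.
  by rewrite le_eqVlt; apply/orP; left; apply/eqP; ring.
apply: ge0_le_integral => //.
- move=> x _; rewrite lee_fin mulr_ge0 ?divr_ge0 ?invr_ge0 ?(ltW s0)//; exact: expR_ge0.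
- apply/measurable_EFinP; apply: (measurable_funS measurableT) => //.
  exact: measurable_normal_pdf.
move=> x; rewrite /= in_itv/= => /hM xM; rewrite lee_fin pdfE//.
rewrite mulrCA -mulrA [leRHS]mulrC ler_pM ?expR_ge0//.
- by rewrite mulr_ge0 ?invr_ge0// ltW.
- rewrite ler_expR subr0 -mulNr.
  rewrite ler_pdivlMr ?mulrn_wgt0 ?exprn_gt0//.
  have : x ^+ 2 <= (M * s) ^+ 2.
    by rewrite -[x ^+ 2]real_normK ?num_real// lerXn2r ?nnegrE// (le_trans _ xM).
  rewrite exprMn -mulr_natr; nra.
- rewrite -invfM /normal_peak lef_pV2 ?posrE ?mulr_gt0//; last first.
    by rewrite sqrtr_gt0 mulrn_wgt0// mulr_gt0 ?pi_gt0// exprn_gt0.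
  have s3 : 0 <= s * 3 by rewrite mulr_ge0// ltW.
  rewrite -[leRHS]ger0_norm// -sqrtr_sqr ler_wsqrtr//.
  have := pihalf_lt2 R; have := exprn_gt0 2 s0; rewrite exprMn -mulr_natr; nra.
Qed.

End gaussian.

(** * Finite combinations of indicators, union bounds, Borel-Cantelli *)

Definition pr {R : realType} {d : measure_display} {T : measurableType d}
  (P : probability T R) (A : set T) : R := fine (P A).

Section probability_tools.
Context {R : realType} {d : measure_display} {T : measurableType d}.
Variable P : probability T R.
Local Notation pr := (pr P).
Implicit Types A B : set T.

Lemma prE A : measurable A -> P A = (pr A)%:E.
Proof. by move=> mA; rewrite /pr fineK// fin_num_measure. Qed.

Lemma pr_ge0 A : 0 <= pr A.
Proof. exact: fine_ge0. Qed.

Lemma pr_le1 A : measurable A -> pr A <= 1.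
Proof. by move=> mA; rewrite -lee_fin -prE// probability_le1. Qed.

Lemma pr_mono A B : measurable A -> measurable B -> A `<=` B -> pr A <= pr B.
Proof. by move=> mA mB AB; rewrite -lee_fin -!prE// le_measure ?inE. Qed.

Lemma prT : pr setT = 1.
Proof. by rewrite /pr probability_setT. Qed.

Lemma pr_setCI A B : measurable A -> measurable B ->
  pr (~` A `&` B) = pr B - pr (A `&` B).
Proof.
move=> mA mB; apply/eqP; rewrite eq_sym subr_eq; apply/eqP.
have mCB : measurable (~` A `&` B) by apply: measurableI => //; exact: measurableC.
have mAB := measurableI _ _ mA mB.
apply: EFin_inj; rewrite EFinD -!prE// -measureU//.
  by rewrite -setIUl setUC setUv setTI.
by rewrite setIACA setICl set0I.
Qed.

Lemma indic1 A w : A w -> \1_A w = 1 :> R.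
Proof. by move=> Aw; rewrite indicE mem_set. Qed.

Lemma indic0 A w : ~ A w -> \1_A w = 0 :> R.
Proof. by move=> Aw; rewrite indicE memNset. Qed.

Lemma indic_01 A w : 0 <= (\1_A w : R) <= 1.
Proof. by rewrite indicE; case: (_ \in _); rewrite ?lexx ?ler01. Qed.

Lemma indic_setI A B w : \1_(A `&` B) w = \1_A w * \1_B w :> R.
Proof. by rewrite indicI. Qed.

Lemma Rintegral_simple (I : Type) (s : seq I) (c : I -> R) (A : I -> set T) :
  (forall i, measurable (A i)) ->
  P.-integrable setT (EFin \o (fun w => \sum_(i <- s) c i * \1_(A i) w)) /\
  (\int[P]_w (\sum_(i <- s) c i * \1_(A i) w))%R = \sum_(i <- s) c i * pr (A i).
Proof.
move=> mA; elim: s => [|i s [ih1 ih2]].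
  have -> : (fun w => \sum_(i <- [::]) c i * \1_(A i) w) = cst 0 :> (T -> R).
    by apply/funext => w; rewrite big_nil.
  rewrite big_nil Rintegral_cst// mul0r; split=> //.
  exact: integrable0.
have -> : (fun w => \sum_(j <- i :: s) c j * \1_(A j) w) =
    (fun w => c i * \1_(A i) w + \sum_(j <- s) c j * \1_(A j) w) :> (T -> R).
  by apply/funext => w; rewrite big_cons.
have i1 : P.-integrable setT (EFin \o (fun w => \1_(A i) w : R)).
  exact: integrable_indic.
have i2 : P.-integrable setT (EFin \o (fun w => c i * \1_(A i) w)).
  exact: (integrableZl measurableT (c i) i1).
split.
  exact: (integrableD measurableT i2 ih1).
rewrite RintegralD// ih2 big_cons RintegralZl//; congr (_ * _ + _).
by rewrite /Rintegral integral_indic// setIT.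
Qed.

(** Integrates a pointwise inequality between combinations of indicators. Markov's inequality, the
    union bound, the disjointness of starting cells and the second-moment argument are all instances
    of it. *)
Lemma simple_le (I J : Type) (s : seq I) (t : seq J) (b : I -> R) (c : J -> R)
    (A : I -> set T) (B : J -> set T) :
  (forall i, measurable (A i)) -> (forall j, measurable (B j)) ->
  (forall w, \sum_(i <- s) b i * \1_(A i) w <= \sum_(j <- t) c j * \1_(B j) w) ->
  \sum_(i <- s) b i * pr (A i) <= \sum_(j <- t) c j * pr (B j).
Proof.
move=> mA mB le_st.
have [i1 <-] := Rintegral_simple s b mA; have [i2 <-] := Rintegral_simple t c mB.
by apply: le_Rintegral.
Qed.

Lemma pr_sub_bigU (J : Type) (t : seq J) A (B : J -> set T) :
  measurable A -> (forall j, measurable (B j)) ->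
  (forall w, A w -> has (fun j => `[< B j w >]) t) ->
  pr A <= \sum_(j <- t) pr (B j).
Proof.
move=> mA mB AB.
have := @simple_le unit J [:: tt] t (fun=> 1) (fun=> 1) (fun=> A) B (fun=> mA) mB.
rewrite big_seq1 mul1r [X in (_ -> _ <= X) -> _](eq_bigr (fun j => pr (B j))); last first.
  by move=> j _; rewrite mul1r.
apply=> w; rewrite big_seq1 mul1r; under eq_bigr do rewrite mul1r.
have pos (r : seq J) : 0 <= \sum_(j <- r) \1_(B j) w :> R.
  by apply: sumr_ge0 => j _; have /andP[] := indic_01 (B j) w.
have [Aw|nAw] := pselect (A w); last by rewrite indic0.
rewrite indic1//; have := AB _ Aw; elim: t {AB} => [//|j t ih] /=; rewrite big_cons.
case/orP => [/asboolP Bw|/ih h]; first by rewrite indic1// lerDl.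
by rewrite (le_trans h)// lerDr; have /andP[] := indic_01 (B j) w.
Qed.

Lemma nneseries_geometric_lty (C q : R) : 0 <= C -> 0 <= q < 1 ->
  (\sum_(0 <= n <oo) (C * q ^+ n)%:E < +oo)%E.
Proof.
move=> C0 /andP[q0 q1].
have cv : cvgn (series (geometric C q)).
  by apply: is_cvg_geometric_series; rewrite ger0_norm.
have -> : (\sum_(0 <= n <oo) (C * q ^+ n)%:E)%E = (limn (series (geometric C q)))%:E.
  rewrite -EFin_lim//; congr (limn _); apply/funext => n /=.
  by rewrite /series/= sumEFin.
by rewrite ltry.
Qed.

Lemma borel_cantelli (F : nat -> set T) (C q : R) :
  (forall n, measurable (F n)) -> 0 <= q < 1 -> 
  (forall n, pr (F n) <= C * q ^+ n) ->
  {ae P, forall w, exists N, forall n, (N <= n)%N -> ~ F n w}.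
Proof.
move=> mF q01 FC.
have C0 : 0 <= C by have := FC 0%N; rewrite expr0 mulr1; exact: le_trans (pr_ge0 _).
exists (lim_sup_set F); split.
- by apply: bigcapT_measurable => n; apply: bigcup_measurable.
- apply: lim_sup_set_cvg0 => //.
  apply: le_lt_trans (nneseries_geometric_lty C0 q01).
  apply: lee_nneseries => [n _ _|n _]; first exact: measure_ge0.
  by have := FC n; rewrite -lee_fin; apply: le_trans; rewrite -prE.
- move=> w /= nw n _; apply: contra_notP nw => h; exists n => m nm Fw.
  by apply: h; exists m.
Qed.

(** A point of [F] would lie in every [G n], against Borel-Cantelli. *)
Lemma ae_not_of_le_geometric (F : set T) (q : R) (G : nat -> set T) :
  (forall n, measurable (G n)) -> 0 <= q < 1 ->
  (forall n, pr (G n) <= q ^+ n) -> (forall n, F `<=` G n) ->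
  {ae P, forall w, ~ F w}.
Proof.
move=> mG q01 Gq FG.
apply: (filterS _ (@borel_cantelli G 1 q mG q01 _)); last by move=> n; rewrite mul1r.
by move=> w [N nG] Fw; exact: (nG N (leqnn N) (FG N w Fw)).
Qed.

End probability_tools.

(** * Increments and their independence of the past *)

Section increments.
Context {R : realType} {d : measure_display} {T : measurableType d}.
Variables (P : probability T R) (B : R -> T -> R).
Hypothesis BM : standard_BM P B.
Local Notation pr := (pr P).

Lemma measurable_fun_incr s t : 0 <= s -> 0 <= t -> measurable_fun setT (incr B s t).
Proof. by case: BM => mB _ _ _ s0 t0; apply: measurable_funB; apply: mB. Qed.

Lemma measurable_incr s t (C : set R) : 0 <= s -> 0 <= t -> measurable C ->
  measurable (incr B s t @^-1` C).
Proof.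
move=> s0 t0 mC; rewrite -[X in measurable X]setTI.
exact: measurable_fun_incr.
Qed.

Let incr_law s t C : 0 <= s -> s < t -> measurable C ->
  (pr (incr B s t @^-1` C))%:E = normal_prob 0 (Num.sqrt (t - s)) C.
Proof.
move=> s0 st mC; case: BM => _ _ law _; rewrite -prE; first exact: law.
by apply: measurable_incr => //; exact: le_trans (ltW st).
Qed.

Let sqrtB_gt0 (s t : R) : s < t -> 0 < Num.sqrt (t - s).
Proof. by rewrite sqrtr_gt0 subr_gt0. Qed.

Lemma pr_incr_tail s t a : 0 <= s -> s < t -> 0 <= a ->
  pr (incr B s t @^-1` [set x | a * Num.sqrt (t - s) <= `|x|]) <=
    2 * expR (- (a ^+ 2 / 2)).
Proof.
move=> s0 st a0; rewrite -lee_fin incr_law//; first exact: normal_tail (sqrtB_gt0 st) a0.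
exact: measurable_tail.
Qed.

Lemma pr_incr_itv_le s t a b : 0 <= s -> s < t -> a <= b ->
  pr (incr B s t @^-1` `[a, b]) <= (b - a) / Num.sqrt (t - s).
Proof.
by move=> s0 st ab; rewrite -lee_fin incr_law//; exact: normal_prob_itv_le (sqrtB_gt0 st) ab.
Qed.

Lemma pr_incr_itv_ge s t a b M : 0 <= s -> s < t -> a <= b ->
  (forall x, a <= x <= b -> `|x| <= M * Num.sqrt (t - s)) ->
  (b - a) / Num.sqrt (t - s) * (expR (- (M ^+ 2 / 2)) / 3) <=
    pr (incr B s t @^-1` `[a, b]).
Proof.
move=> s0 st ab hM; rewrite -lee_fin incr_law//.
exact: normal_prob_itv_ge (sqrtB_gt0 st) ab hM.
Qed.

(** Generators of the history at integer times up to [s]. Increments are used instead of values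
    because independence is stated for increments and [B 0] vanishes only almost surely. *)
Definition cylinders (s : nat) : set (set T) :=
  [set A | exists2 C : nat -> set R, (forall i, measurable (C i)) &
    A = \bigcap_(i in `I_s) (incr B i%:R i.+1%:R @^-1` C i)].

Definition past (s : nat) : set (set T) := <<s cylinders s >>.

Lemma cylindersI s : setI_closed (cylinders s).
Proof.
move=> _ _ [C mC ->] [D mD ->]; exists (fun i => C i `&` D i).
  by move=> i; exact: measurableI.
by rewrite -bigcapI; apply: eq_bigcapr => i _; rewrite preimage_setI.
Qed.

Lemma cylinders_measurable s : cylinders s `<=` measurable.
Proof.
move=> _ [C mC ->]; apply: fin_bigcap_measurable => // i _; exact: measurable_incr.
Qed.

Lemma past_measurable s : past s `<=` measurable.
Proof.
apply: smallest_sub; last exact: cylinders_measurable.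
exact: sigma_algebra_measurable.
Qed.

(* The pi-lambda theorem extends the product rule for increments to the past. *)
Lemma past_independent (s b c : nat) (A : set T) (C D : set R) :
  (s < b)%N -> (b < c)%N -> measurable C -> measurable D -> past s A ->
  pr (A `&` (incr B s%:R b%:R @^-1` C `&` incr B b%:R c%:R @^-1` D)) =
  pr A * (pr (incr B s%:R b%:R @^-1` C) * pr (incr B b%:R c%:R @^-1` D)).
Proof.
move=> sb bc mC mD.
set E := incr B s%:R b%:R @^-1` C `&` _.
have mE : measurable E by apply: measurableI; exact: measurable_incr.
(* The single partition 0, 1, ..., [s], [b], [c] carries the cylinder and the two later increments;
   [G] below distributes the sets along it. *)
pose ts i : R := if (i <= s)%N then i%:R else if i == s.+1 then b%:R else c%:R.
have tsi i : (i < s.+2)%N -> ts i < ts i.+1.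
  rewrite /ts !ltnS => i1; case: (ltngtP i s) => i2.
  - by rewrite ltr_nat.
  - have -> : i = s.+1 by apply/eqP; rewrite eqn_leq i1 i2.
    by rewrite !eqxx (gtn_eqF (ltnSn s.+1)) ltr_nat.
  - by rewrite i2 eqxx ltr_nat.
have [_ _ _ indep] := BM.
have cyl A' : cylinders s A' -> pr (A' `&` E) =
  pr A' * (pr (incr B s%:R b%:R @^-1` C) * pr (incr B b%:R c%:R @^-1` D)).
  move=> [F mF ->].
  have lt_nat i : (i < s)%N -> (i%:R : R) < i.+1%:R by rewrite ltr_nat.
  rewrite {2}/pr (indep s (fun i => i%:R) (lexx _) lt_nat F mF)/=.
  pose G i := if (i < s)%N then F i else if i == s then C else D.
  have mG i : measurable (G i) by rewrite /G; case: ifP => // _; case: ifP.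
  have e1 i : (i < s)%N ->
      incr B (ts i) (ts i.+1) @^-1` G i = incr B i%:R i.+1%:R @^-1` F i.
    by move=> i_s; rewrite /ts /G i_s (ltnW i_s).
  have e2 : incr B (ts s) (ts s.+1) @^-1` G s = incr B s%:R b%:R @^-1` C.
    by rewrite /ts /G leqnn ltnn !eqxx.
  have e3 : incr B (ts s.+1) (ts s.+2) @^-1` G s.+1 = incr B b%:R c%:R @^-1` D.
    have n1 : (s.+1 < s)%N = false by rewrite ltnNge leqnSn.
    by rewrite /ts /G ltnn n1 !eqxx !gtn_eqF.
  have ts0 : 0 <= ts 0%N by rewrite /ts.
  have := congr1 fine (indep s.+2 ts ts0 tsi G mG).
  rewrite big_ord_recr big_ord_recr/= e2 e3.
  rewrite (eq_bigr (fun i : 'I_s => pr (incr B i%:R i.+1%:R @^-1` F i))); last first.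
    by move=> i _; rewrite e1.
  rewrite -mulrA => <-.
  rewrite /pr; congr (fine (P _)); apply/seteqP; split => [w [AF [wC wD]] i /= is2|w Gw].
    move: is2; rewrite ltnS leq_eqVlt => /predU1P[->|].
      by suff: (incr B b%:R c%:R @^-1` D) w by rewrite -e3.
    rewrite ltnS leq_eqVlt => /predU1P[->|i_s].
      by suff: (incr B s%:R b%:R @^-1` C) w by rewrite -e2.
    suff: (incr B i%:R i.+1%:R @^-1` F i) w by rewrite -e1.
    exact: AF.
  split => [i /= i_s|].
    suff: (incr B i%:R i.+1%:R @^-1` F i) w by [].
    by rewrite -e1//; apply: Gw; rewrite /= ltnW// ltnS ltnW.
  split; first by rewrite -e2; apply: Gw => /=.
  by rewrite -e3; apply: Gw => /=.
set q := pr _ * pr _ in cyl *.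
have Eq : pr E = q.
  have := cyl setT; rewrite setTI prT mul1r; apply.
  by exists (fun=> setT) => //; rewrite bigcapT.
clearbody q.
(* The sets obeying the product rule form a Dynkin system that contains the pi-system of
   cylinders. *)
suff : past s `<=` [set A | measurable A /\ pr (A `&` E) = pr A * q].
  by move=> /[apply] -[].
apply: lambda_system_subset => //; first exact: cylindersI.
  apply/dynkin_lambda_system; split.
  - by split=> //; rewrite setTI prT mul1r.
  - move=> A' [mA' A'E]; split; first exact: measurableC.
    have := pr_setCI P mA' measurableT; rewrite !setIT prT => ->.
    by rewrite pr_setCI// A'E Eq mulrBl mul1r.
  - move=> F tF FE; have mF n : measurable (F n) := (FE n).1.
    have FEq n : pr (F n `&` E) = pr (F n) * q := (FE n).2.
    have mbF := bigcupT_measurable F mF.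
    split=> //; have mFE n := measurableI _ _ (mF n) mE.
    have tFE : trivIset setT (fun n => F n `&` E).
      by apply: trivIset_setIr.
    have mFEb : measurable (\bigcup_n (F n `&` E)) by exact: bigcupT_measurable.
    apply: EFin_inj; rewrite setI_bigcupl -prE// measure_semi_bigcup//.
    rewrite (eq_eseriesr (g := fun n => q%:E * P (F n))%E); last first.
      move=> n _; apply: (etrans (prE P (mFE n))).
      by rewrite FEq mulrC EFinM; congr (_ * _)%E; rewrite -(prE P (mF n)).
    rewrite nneseriesZl// mulrC EFinM; congr (_ * _)%E.
    by apply: etrans (prE P mbF); rewrite measure_semi_bigcup.
move=> A' cA'; split; [exact: cylinders_measurable cA'|exact: cyl].
Qed.

Lemma pastI s (A A' : set T) : past s A -> past s A' -> past s (A `&` A').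
Proof. by apply: (@measurableI _ (g_sigma_algebraType (cylinders s))). Qed.

Lemma pastC s (A : set T) : past s A -> past s (~` A).
Proof. by apply: (@measurableC _ (g_sigma_algebraType (cylinders s))). Qed.

Lemma pastT s : past s setT.
Proof. exact: (@measurableT _ (g_sigma_algebraType (cylinders s))). Qed.

Lemma past_bigcup s (F : nat -> set T) :
  (forall n, past s (F n)) -> past s (\bigcup_n F n).
Proof. by apply: (@bigcupT_measurable _ (g_sigma_algebraType (cylinders s))). Qed.

Lemma past_mono s t : (s <= t)%N -> past s `<=` past t.
Proof.
move=> st; apply: smallest_sub; first exact: smallest_sigma_algebra.
move=> _ [C mC ->]; apply: sub_gen_smallest.
exists (fun i => if (i < s)%N then C i else setT); first by move=> i; case: ifP.
apply/seteqP; split=> w CA i /= i_t; first by case: ifP => // i_s; exact: CA.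
have := CA i (leq_trans i_t st); by rewrite i_t.
Qed.

(** Such an increment is a difference of two increments from time 0, and these telescope into the
    unit increments that generate the past. *)
Lemma measurable_fun_past_incr s i j : (i <= s)%N -> (j <= s)%N ->
  measurable_fun setT (incr B i%:R j%:R : g_sigma_algebraType (cylinders s) -> R).
Proof.
have h0 k : (k <= s)%N ->
    measurable_fun setT (incr B 0 k%:R : g_sigma_algebraType (cylinders s) -> R).
  elim: k => [|k ih] ks.
    rewrite (_ : incr _ _ _ = cst 0)//; apply/funext => w; exact: subrr.
  rewrite (_ : incr _ _ _ = incr B 0 k%:R \+ incr B k%:R k.+1%:R); last first.
    by apply/funext => w; rewrite /incr/=; ring.
  apply: measurable_funD; first exact: ih (ltnW ks).
  move=> _ C mC; rewrite setTI; apply: sub_gen_smallest.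
  exists (fun i => if i == k then C else setT); first by move=> l; case: ifP.
  apply/seteqP; split=> w /= Cw; first by move=> l _; case: eqP => // ->.
  by have := Cw k ks; rewrite eqxx.
move=> i_s js; rewrite (_ : incr _ _ _ = incr B 0 j%:R \- incr B 0 i%:R); last first.
  by apply/funext => w; rewrite /incr/=; ring.
by apply: measurable_funB; exact: h0.
Qed.

Lemma past_incr s i j (C : set R) : (i <= s)%N -> (j <= s)%N -> measurable C ->
  past s (incr B i%:R j%:R @^-1` C).
Proof.
move=> i_s js mC.
have := measurable_fun_past_incr i_s js measurableT mC.
by rewrite setTI.
Qed.

End increments.

(** * Covering costs and energies *)

Section nu_facts.
Context {R : realType}.
Implicit Types (E : set R) (rho : R) (n : nat).
Local Notation itvs := ((int * int) * (bool * bool))%type.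

Definition covers n E (Q : seq itvs) : Prop :=
  (forall q, q \in Q -> admissible (R := R) n q) /\
  E `&` dyadic_shell n `<=` [set x | exists2 q, q \in Q & int_interval q x].

Lemma cover_cost_ge0 n rho (Q : seq itvs) : 0 <= cover_cost n rho Q.
Proof. by apply: sumr_ge0 => q _; exact: powR_ge0. Qed.

Lemma nu_le n rho E Q : covers n E Q -> nu n rho E <= cover_cost n rho Q.
Proof.
move=> [aQ EQ]; apply: ge_inf; last by exists Q.
by exists 0 => _ [Q' [_ [_ ->]]]; exact: cover_cost_ge0.
Qed.

(** The shell is itself admissible, so the infimum defining [nu] runs over a nonempty set and lower
    bounds pass to it. *)
Lemma covers_shell n E : (0 < n)%N ->
  covers n E [:: ((Posz (2 ^ n.-1), Posz (2 ^ n)), (true, false))].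
Proof.
move=> n0; split=> [q|x [_ [x1 x2]]].
  rewrite inE => /eqP ->; split => /=.
    by rewrite ltz_nat ltn_exp2l// prednK.
  by move=> x; rewrite /int_interval/= in_itv/= -!pmulrn !natrX => /andP[].
exists ((Posz (2 ^ n.-1), Posz (2 ^ n)), (true, false)); first by rewrite inE.
by rewrite /int_interval/= in_itv/= -!pmulrn !natrX x1 x2.
Qed.

Lemma le_nu n rho E c : (0 < n)%N ->
  (forall Q, covers n E Q -> c <= cover_cost n rho Q) -> c <= nu n rho E.
Proof.
move=> n0 hc; apply: lb_le_inf.
  exists (cover_cost n rho [:: ((Posz (2 ^ n.-1), Posz (2 ^ n)), (true, false))]).
  by have [? ?] := covers_shell E n0; eexists; split; [eassumption|split].
by move=> _ [Q [aQ [EQ ->]]]; exact: hc.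
Qed.

Lemma nu_ge0 n rho E : (0 < n)%N -> 0 <= nu n rho E.
Proof. by move=> n0; apply: le_nu => // Q _; exact: cover_cost_ge0. Qed.

(** Whatever the endpoint booleans, the open interval between the endpoints lies in the shell. If it
    were longer than [2 ^+ n], one of the midpoints below would belong to it and lie outside the
    shell. *)
Lemma admissible_length n (q : itvs) : (0 < n)%N -> admissible (R := R) n q ->
  0 < ((q.1.2 - q.1.1)%:~R / 2 ^+ n : R) <= 1.
Proof.
case: n => // n _; case: q => [[a b] [l r]] [/= ab sub].
have n2 : 0 < 2 ^+ n.+1 :> R by rewrite exprn_gt0.
have abR : (a%:~R : R) < b%:~R by rewrite ltr_int.
apply/andP; split; first by rewrite divr_gt0// intrD intrN subr_gt0.
rewrite ler_pdivrMr// mul1r intrD intrN.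
have pn : 0 <= 2 ^+ n :> R by rewrite exprn_ge0.
rewrite leNgt; apply/negP => big.
have inside x : (a%:~R : R) < x < b%:~R -> 2 ^+ n <= x /\ x < 2 ^+ n.+1.
  move=> /andP[ax xb]; apply: sub; rewrite /int_interval/= in_itv/=.
  by case: l r => -[] /=; rewrite ?ax ?xb ?(ltW ax) ?(ltW xb).
have e2 : 2 ^+ n.+1 = 2 * 2 ^+ n :> R by rewrite exprS.
have [h1|h1] := leP (b%:~R : R) (2 ^+ n.+1).
  have [h2|h2] := leP (b%:~R : R) (2 ^+ n).
    have [] := inside (((a%:~R : R) + b%:~R) / 2); lra.
  have [] := inside (((a%:~R : R) + 2 ^+ n) / 2); lra.
have [h2|h2] := leP (a%:~R : R) (2 ^+ n.+1).
  have [] := inside ((2 ^+ n.+1 + b%:~R) / 2); lra.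
have [] := inside (((a%:~R : R) + b%:~R) / 2); lra.
Qed.

(** Normalized lengths are at most 1, so their powers decrease with the exponent. *)
Lemma nu_mono n rho rho' E : (0 < n)%N -> rho <= rho' ->
  nu n rho' E <= nu n rho E.
Proof.
move=> n0 le_rho; apply: le_nu => // Q cQ; apply: (le_trans (nu_le _ cQ)).
rewrite /cover_cost big_seq [leRHS]big_seq; apply: ler_sum => q qQ.
have /andP[q0 q1] := admissible_length n0 (cQ.1 q qQ).
by rewrite ger_powR// q0.
Qed.

Lemma nu_le_count n rho E (S : seq nat) : (0 < n)%N ->
  (forall k, k \in S -> (2 ^ n.-1 <= k < 2 ^ n)%N) ->
  E `&` dyadic_shell n `<=`
    [set t | exists2 k, k \in S & (k%:R <= t /\ t < k.+1%:R)] ->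
  nu n rho E <= (size S)%:R * powR (1 / 2 ^+ n) rho.
Proof.
move=> n0 hS ES.
pose Q : seq itvs := [seq ((Posz k, Posz k.+1), (true, false)) | k <- S].
apply: (@le_trans _ _ (cover_cost n rho Q)).
  apply: nu_le; split=> [_ /mapP[k /hS /andP[k1 k2] ->]|x /ES [k kS [kx xk]]].
    split=> [/=|x]; first by rewrite ltz_nat.
    rewrite /int_interval/= in_itv/= -!pmulrn => /andP[kx xk]; split.
      by apply: le_trans kx; rewrite -natrX ler_nat.
    by apply: lt_le_trans xk _; rewrite -natrX ler_nat.
  exists ((Posz k, Posz k.+1), (true, false)); first by apply/mapP; exists k.
  by rewrite /int_interval/= in_itv/= -!pmulrn kx xk.
rewrite /cover_cost big_map /=.
under eq_bigr => k _ do rewrite (_ : (Posz k.+1 - Posz k)%R = 1) ?subzn// ?subSnn//.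
by rewrite big_const_seq count_predT iter_addr_0 mulr_natl.
Qed.

Lemma int_interval_bounds (q : itvs) (t : R) :
  int_interval q t -> q.1.1%:~R <= t /\ t <= q.1.2%:~R.
Proof.
by case: q => [[a b] [[] []]]; rewrite /int_interval/= in_itv/= => /andP[? ?];
  split; rewrite // ltW.
Qed.

(** Subtraction being truncated, the inner maximum is the distance of [k] and [l]. It is raised to
    at least 1, so the diagonal takes the value at distance one. *)
Definition riesz n rho (k l : nat) : R :=
  powR ((maxn (maxn (k - l) (l - k)) 1)%:R / 2 ^+ n) (- rho).

Definition energy n rho (S : seq nat) : R := \sum_(k <- S) \sum_(l <- S) riesz n rho k l.

Lemma riesz_ge0 n rho k l : 0 <= riesz n rho k l.
Proof. exact: powR_ge0. Qed.

(* Points of [S] meeting the same covering interval are close, so their mutual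
   energies are large; completing the square trades energy for covering cost. *)
Lemma energy_le_cost n rho (lam : R) (S : seq nat) (Q : seq itvs) : (0 < n)%N ->
  0 <= rho <= 1 -> (forall q, q \in Q -> admissible (R := R) n q) ->
  (forall k, k \in S -> exists2 q, q \in Q &
     exists2 t : R, int_interval q t & (k%:R <= t /\ t <= k.+1%:R)) ->
  2 * lam * (size S)%:R - lam ^+ 2 * energy n rho S <= 2 * cover_cost n rho Q.
Proof.
move=> n0 /andP[rho0 rho1]; elim: Q S => [|q Q ih] S aQ SQ.
  case: S SQ => [_|k S /(_ k)]; last by rewrite inE eqxx => /(_ isT) [].
  by rewrite /energy big_nil /cover_cost big_nil/= !mulr0 subrr.
(* Induction on the cover: [S1] is charged to the first interval, [S2] meets only the others. The
   kernel is nonnegative, so dropping the cross terms can only lower the energy. *)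
pose meets k := `[< exists2 t : R, int_interval q t & (k%:R <= t /\ t <= k.+1%:R) >].
pose S1 := [seq k <- S | meets k]; pose S2 := [seq k <- S | ~~ meets k].
have {}ih : 2 * lam * (size S2)%:R - lam ^+ 2 * energy n rho S2 <= 2 * cover_cost n rho Q.
  apply: ih => [r rQ|k]; first by apply: aQ; rewrite inE rQ orbT.
  rewrite mem_filter => /andP[/= /asboolP nk /SQ [r]].
  by rewrite inE => /predU1P[-> //|rQ kr]; exists r.
have [aq /admissible_length] : admissible (R := R) n q * admissible (R := R) n q.
  by split; apply: aQ; rewrite inE eqxx.
move=> /(_ n0) /andP[]; set v := _ / _ => v0 v1.
have eS : perm_eq (S1 ++ S2) S by rewrite perm_filterC.
have sS : (size S)%:R = (size S1)%:R + (size S2)%:R :> R.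
  by rewrite -natrD -size_cat (perm_size eS).
have enS : energy n rho S1 + energy n rho S2 <= energy n rho S.
  have -> : energy n rho S = energy n rho (S1 ++ S2).
    rewrite /energy -(perm_big _ eS); apply: eq_bigr => k _.
    by rewrite (perm_big _ eS).
  rewrite /energy big_cat lerD//; apply: ler_sum => k _; rewrite big_cat/=.
    by rewrite lerDl sumr_ge0// => l _; exact: riesz_ge0.
  by rewrite lerDr sumr_ge0// => l _; exact: riesz_ge0.
have u0 : 0 < powR v rho by rewrite powR_gt0.
have en1 : (size S1)%:R ^+ 2 / (2 * powR v rho) <= energy n rho S1.
  rewrite /energy.
  have -> : (size S1)%:R ^+ 2 / (2 * powR v rho) =
      \sum_(k <- S1) \sum_(l <- S1) (2 * powR v rho)^-1.
    by rewrite !big_const_seq !count_predT !iter_addr_0 -mulrnA -[RHS]mulr_natl natrM expr2.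

  rewrite big_seq [leRHS]big_seq; apply: ler_sum => k kS.
  rewrite big_seq [leRHS]big_seq; apply: ler_sum => l lS.
  rewrite /riesz powRN; set D := maxn _ _.
  have D0 : 0 < D%:R / 2 ^+ n :> R.
    by rewrite divr_gt0 ?exprn_gt0// ltr0n leq_max orbT.
  have p0 := powR_gt0 rho D0; have p1 := mulr_gt0 (ltr0n _ 2) u0.
  suff : powR (D%:R / 2 ^+ n) rho <= 2 * powR v rho by rewrite lef_pV2 ?posrE.
  (* Unit intervals meeting an interval with endpoints [a] and [b] start at most [b - a + 1] apart,
     and [b - a >= 1] for integers [a < b]. Then [powR 2 rho <= 2] yields the claim. *)
  have Dv : D%:R / 2 ^+ n <= 2 * v.
    rewrite mulrA ler_pM2r ?invr_gt0 ?exprn_gt0//.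
    move: aq kS lS => [+ _]; rewrite !mem_filter => ab.
    move=> /andP[/asboolP[t tq [kt tk]] _] /andP[/asboolP[t' tq' [kt' tk']] _].
    have [at1 tb] := int_interval_bounds tq.
    have [at1' tb'] := int_interval_bounds tq'.
    have ab1 : (q.1.1%:~R : R) + 1 <= q.1.2%:~R by rewrite -[1]/(1%:~R) -intrD ler_int lezD1.
    rewrite intrD intrN.
    have hmax : D%:R <= q.1.2%:~R - q.1.1%:~R + 1 :> R.
      rewrite /D; move: kt tk kt' tk'; rewrite -!natr1 => kt tk kt' tk'.
      have [kl|kl] := leqP k l.
        rewrite (eqP (kl : k - l == 0)%N) max0n.
        rewrite /maxn; case: ifP => _; first by lra.
        by rewrite natrB//; lra.
      have lk0 : (l - k == 0)%N by rewrite subn_eq0 ltnW.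
      rewrite (eqP lk0) maxn0 (maxn_idPl _) ?subn_gt0//.
      by rewrite natrB ?(ltnW kl)//; lra.
    lra.
  apply: (@le_trans _ _ (powR (2 * v) rho)).
    rewrite ge0_ler_powR// nnegrE; first by rewrite divr_ge0// exprn_ge0.
    by rewrite mulr_ge0// ltW.
  rewrite powRM ?(ltW v0)// ler_pM2r//.
  by rewrite -[leRHS]powRr1// ler_powR// ler1n.
have key : 2 * lam * (size S1)%:R - lam ^+ 2 * energy n rho S1 <= 2 * powR v rho.
  set a := (size S1)%:R; set u := powR v rho in u0 en1 *.
  apply: (@le_trans _ _ (2 * lam * a - lam ^+ 2 * (a ^+ 2 / (2 * u)))).
    by rewrite lerD2l lerN2 ler_wpM2l ?sqr_ge0.
  rewrite -subr_ge0 (_ : _ - _ = (2 * u - lam * a) ^+ 2 / (2 * u)); last first.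
    by field; rewrite gt_eqF.
  by rewrite divr_ge0 ?sqr_ge0// mulr_ge0 ?ltW.
rewrite /cover_cost big_cons -/(cover_cost n rho Q) -/v.
have := mulr_ge0 (sqr_ge0 lam) (_ : 0 <= energy n rho S - (energy n rho S1 + energy n rho S2)).
rewrite subr_ge0 => /(_ enS); rewrite sS; move: key ih.
move: (energy _ _ S) (energy _ _ S1) (energy _ _ S2) (cover_cost _ _ _) (powR _ _).
by move=> e e1 e2 c p; lra.
Qed.

(** Normalized distances are at most 1, so the kernel is at least 1 and the energy at least [|S|^2];
    then [2 t - t^2 <= 1] with [t = lam |S|]. *)
Lemma energy_le1 n rho (lam : R) (S : seq nat) : 0 <= rho ->
  (forall k, k \in S -> (k < 2 ^ n)%N) ->
  2 * lam * (size S)%:R - lam ^+ 2 * energy n rho S <= 1.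
Proof.
move=> rho0 hS.
have : (size S)%:R ^+ 2 <= energy n rho S.
  have -> : (size S)%:R ^+ 2 = \sum_(k <- S) \sum_(l <- S) 1 :> R.
    by rewrite !big_const_seq !count_predT !iter_addr_0 -mulrnA expr2 natrM.
  rewrite /energy big_seq [leRHS]big_seq; apply: ler_sum => k /hS kn.
  rewrite big_seq [leRHS]big_seq; apply: ler_sum => l /hS ln.
  have D0 : 0 < (maxn (maxn (k - l) (l - k)) 1)%:R / 2 ^+ n :> R.
    by rewrite divr_gt0 ?exprn_gt0// ltr0n leq_max orbT.
  rewrite /riesz powRN invr_ge1 ?unitfE ?gt_eqF ?powR_gt0//.
  apply: (@le_trans _ _ (powR 1 rho)); last by rewrite powR1.
  rewrite ge0_ler_powR ?nnegrE ?(ltW D0)//.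
  rewrite ler_pdivrMr ?exprn_gt0// mul1r -natrX ler_nat.
  rewrite !geq_max expn_gt0/= andbT.
  by rewrite !(leq_trans (leq_subr _ _)) ?(ltnW kn) ?(ltnW ln).
move=> sE; have := mulr_ge0 (sqr_ge0 lam) (_ : 0 <= energy n rho S - (size S)%:R ^+ 2).
rewrite subr_ge0 => /(_ sE); have := sqr_ge0 (lam * (size S)%:R - 1).
by move: (energy _ _ S) (size S)%:R => e z; lra.
Qed.

End nu_facts.

(** * Summability of covering costs and the dimension *)

Section dimension.
Context {R : realType}.
Implicit Types (E : set R) (rho : R) (n : nat).

Lemma nu_summable E rho (C q : R) N : 0 <= C -> 0 < q < 1 ->
  (forall n, (N <= n)%N -> nu n rho E <= C * q ^+ n) ->
  (\sum_(1 <= n <oo) (nu n rho E)%:E < +oo)%E.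
Proof.
move=> C0 /andP[q0 q1] h.
(* [D] absorbs the finitely many terms before [N] into the geometric bound. *)
pose D := \sum_(m < N) `|nu m rho E| / q ^+ m.
have D0 : 0 <= D by apply: sumr_ge0 => m _; rewrite divr_ge0// exprn_ge0// ltW.
have bound n : nu n rho E <= (C + D) * q ^+ n.
  have qn : 0 < q ^+ n by rewrite exprn_gt0.
  have [/h le_nu|nN] := leqP N n.
    by rewrite (le_trans le_nu)// ler_wpM2r ?(ltW qn)// lerDl.
  rewrite -ler_pdivrMr// (@le_trans _ _ D) ?lerDr//.
  rewrite /D (bigD1 (Ordinal nN))//= (@le_trans _ _ (`|nu n rho E| / q ^+ n))//.
    by rewrite ler_wpM2r ?invr_ge0 ?(ltW qn)// ler_norm.
  by rewrite lerDl; apply: sumr_ge0 => m _; rewrite divr_ge0// exprn_ge0// ltW.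
have CD0 : 0 <= C + D by rewrite addr_ge0.
have q01 : 0 <= q < 1 by rewrite (ltW q0).
apply: le_lt_trans (nneseries_geometric_lty CD0 q01).
have v0 n : (0 <= ((C + D) * q ^+ n)%:E)%E.
  by rewrite lee_fin mulr_ge0// exprn_ge0// ltW.
rewrite (@nneseries_split _ _ 0 1) => [|k _]; last exact: v0.
rewrite (@le_trans _ _ (\sum_(1 <= n <oo) ((C + D) * q ^+ n)%:E)%E)//.
  by apply: lee_nneseries => [n n1 _|n _]; rewrite lee_fin ?nu_ge0.
by rewrite leeDr// sume_ge0.
Qed.

Lemma nu_not_summable E rho (c : R) : 0 < c ->
  (forall N, exists2 n, (N < n)%N & c <= nu n rho E) ->
  ~ (\sum_(1 <= n <oo) (nu n rho E)%:E < +oo)%E.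
Proof.
move=> c0 often fin.
have partial K : exists M, c *+ K <= \sum_(1 <= n < M.+1) nu n rho E.
  elim: K => [|K [M hM]]; first by exists 0%N; rewrite big_geq.
  have [n Mn cn] := often M; exists n.
  rewrite mulrSr big_nat_recr ?(leq_trans _ Mn)//= lerD//.
  rewrite (le_trans hM)// [leRHS](big_cat_nat _ (n := M.+1))//= lerDl.
  rewrite big_nat; apply: sumr_ge0 => i /andP[Mi _]; rewrite nu_ge0//.
  exact: leq_trans Mi.
have nn n : (1 <= n)%N -> (0 <= (nu n rho E)%:E)%E.
  by move=> n1; rewrite lee_fin nu_ge0.
set S := (\sum_(1 <= n <oo) _)%E in fin.
have S_ge K : ((c *+ K)%:E <= S)%E.
  have [M hM] := partial K.
  apply: (@le_trans _ _ (\sum_(1 <= n < M.+1) (nu n rho E)%:E)%E).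
    by rewrite sumEFin lee_fin.
  apply: nneseries_lim_ge => n n1 _; exact: nn.
have S0 : (0 <= S)%E by have := S_ge 0%N; rewrite mulr0n.
have Sfin : S \is a fin_num by rewrite ge0_fin_numE.
have := S_ge (Num.truncn (fine S / c)).+1.
rewrite -(fineK Sfin) lee_fin -mulr_natr -ler_pdivlMl// mulrC leNgt.
by rewrite truncnS_gt.
Qed.

Lemma macro_dimH_eq E (h : R) : 0 <= h ->
  (forall rho, h < rho -> (\sum_(1 <= n <oo) (nu n rho E)%:E < +oo)%E) ->
  (forall rho, 0 <= rho < h -> ~ (\sum_(1 <= n <oo) (nu n rho E)%:E < +oo)%E) ->
  macro_dimH E = h.
Proof.
move=> h0 above below; rewrite /macro_dimH.
set D := [set rho | _].
have lbD : lbound D h.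
  move=> rho [rho0 sum_rho]; rewrite leNgt; apply/negP => rho_h.
  by apply: below sum_rho; rewrite rho0.
apply/eqP; rewrite eq_le; apply/andP; split; last first.
  apply: lb_le_inf => //; exists (h + 1); split; first by rewrite addr_ge0.
  by apply: above; rewrite ltrDl.
apply/ler_addgt0Pr => e e0; apply: ge_inf; first by exists h.
by split; [rewrite addr_ge0// ltW|apply: above; rewrite ltrDl].
Qed.

End dimension.

(** * Oscillation of the path on unit intervals *)

Section chaining.
Context {R : realType}.

(** Approximate [t] from below by dyadic points [u j]. The numerator of [u j.+1] is twice that of
    [u j], or one more, so consecutive approximations are equal or differ by one increment of level
    [j.+1]. The increments sum geometrically, and continuity at [t] closes the chain. *)
Lemma dyadic_chain (f : R -> R) (k : nat) (a t : R) : 0 <= a ->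
  {within [set u | 0 <= u], continuous f} ->
  (forall j i, (i < 2 ^ j)%N ->
     `|f (k%:R + i.+1%:R / 2 ^+ j) - f (k%:R + i%:R / 2 ^+ j)| <= a * (3 / 4) ^+ j) ->
  k%:R <= t < k.+1%:R -> `|f t - f k%:R| <= 4 * a.
Proof.
move=> a0 cf hinc /andP[kt tk].
have p2 j : 0 < 2 ^+ j :> R by rewrite exprn_gt0.
pose i_ j := Num.truncn ((t - k%:R) * 2 ^+ j).
have i_P j : (i_ j)%:R <= (t - k%:R) * 2 ^+ j < (i_ j).+1%:R.
  by apply: truncn_itv; rewrite mulr_ge0 ?subr_ge0// ltW.
pose u j : R := k%:R + (i_ j)%:R / 2 ^+ j.
have i_lt j : (i_ j < 2 ^ j)%N.
  rewrite -(ltr_nat R) natrX; have /andP[/le_lt_trans-> //] := i_P j.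
  by rewrite -[ltRHS]mul1r ltr_pM2r// ltrBlDl natr1.
(* The factor 4 is [1 / (1 - 3 / 4)]; the subtracted power leaves room for the next increment in the
   induction. *)
have bound j : `|f (u j) - f k%:R| <= 4 * a * (1 - (3 / 4) ^+ j).
  elim: j => [|j ih].
    have -> : u 0%N = k%:R.
      by have := i_lt 0%N; rewrite /u expn0 ltnS leqn0 => /eqP ->; rewrite mul0r addr0.
    by rewrite subrr normr0 expr0 subrr mulr0.
  have step : `|f (u j.+1) - f (u j)| <= a * (3 / 4) ^+ j.+1.
    have uE : u j = k%:R + (2 * i_ j)%:R / 2 ^+ j.+1.
      by rewrite /u exprS natrM; congr (_ + _); field; rewrite gt_eqF.
    have /andP[h1 h2] := i_P j; have /andP[h3 h4] := i_P j.+1.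
    have e1 : (t - k%:R) * 2 ^+ j.+1 = 2 * ((t - k%:R) * 2 ^+ j) by rewrite exprS; ring.
    have lo : (2 * i_ j < (i_ j.+1).+1)%N.
      rewrite -(ltr_nat R) natrM; apply: le_lt_trans h4; rewrite e1; lra.
    have hi : (i_ j.+1 < 2 * (i_ j).+1)%N.
      rewrite -(ltr_nat R) natrM; apply: (le_lt_trans h3); rewrite e1; lra.
    have [ij1|ij1] : i_ j.+1 = (2 * i_ j)%N \/ i_ j.+1 = (2 * i_ j).+1.
      by move: lo hi; clear; move: (i_ j) (i_ j.+1) => x y; lia.
    - by rewrite uE /u ij1 subrr normr0 mulr_ge0// exprn_ge0// divr_ge0.
    - by rewrite uE /u ij1; apply: hinc; rewrite expnS ltn_pmul2l.
  rewrite (le_trans (ler_distD (f (u j)) _ _))//.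
  rewrite (le_trans (lerD step ih))// exprS.
  have : 0 <= a * (3 / 4) ^+ j by rewrite mulr_ge0// exprn_ge0// divr_ge0.
  by move: ((3 / 4) ^+ j) => z; lra.
have bound4 j : `|f (u j) - f k%:R| <= 4 * a.
  rewrite (le_trans (bound j))//.
  have : 0 <= a * (3 / 4) ^+ j by rewrite mulr_ge0// exprn_ge0// divr_ge0.
  by move: ((3 / 4) ^+ j) => z; lra.
have t0 : 0 <= t by rewrite (le_trans _ kt).
apply/ler_addgt0Pr => e e0.
have /subspace_continuousP/(_ t t0)/cvgrPdist_lt/(_ e e0) := cf.
rewrite near_withinE => /nbhs_ballP[dl /= dl0 hdl].
have [j hj] : exists j, (2 ^+ j)^-1 < dl.
  exists (Num.truncn dl^-1).+1; rewrite invf_plt ?posrE//.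
  rewrite (lt_trans (truncnS_gt _))// -natrX ltr_nat; exact: ltn_expl.
have /andP[h1 h2] := i_P j.
have near_u : `|f t - f (u j)| < e.
  apply: hdl => /=; last by rewrite addr_ge0// divr_ge0// ltW.
  rewrite /ball/= ger0_norm /u.
    apply: le_lt_trans hj; rewrite opprD addrA lerBlDr.
    rewrite (_ : (2 ^+ j)^-1 + _ = (i_ j).+1%:R / 2 ^+ j).
      by rewrite ler_pdivlMr// ltW.
    by rewrite -natr1; field; rewrite gt_eqF.
  by rewrite opprD addrA subr_ge0 ler_pdivrMr.
rewrite (le_trans (ler_distD (f (u j)) _ _))// addrC lerD//; exact: ltW.
Qed.

End chaining.

Section oscillation.
Context {R : realType} {d : measure_display} {T : measurableType d}.
Variables (P : probability T R) (B : R -> T -> R).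
Hypothesis BM : standard_BM P B.
Local Notation pr := (pr P).

(** The factor [Num.sqrt (2 ^+ j)] cancels the standard deviation: the threshold is really
    [8 * n.+1%:R * (3 / 4) ^+ j], put in the form of the Gaussian tail bound. *)
Let bad (n j k i : nat) : set T :=
  incr B (k%:R + i%:R / 2 ^+ j) (k%:R + i.+1%:R / 2 ^+ j) @^-1`
    [set x | (8 * n.+1%:R * (3 / 4) ^+ j * Num.sqrt (2 ^+ j)) *
       Num.sqrt (k%:R + i.+1%:R / 2 ^+ j - (k%:R + i%:R / 2 ^+ j)) <= `|x|].

Let badE n j k i w : ~ bad n j k i w ->
  `|incr B (k%:R + i%:R / 2 ^+ j) (k%:R + i.+1%:R / 2 ^+ j) w| <=
    8 * n.+1%:R * (3 / 4) ^+ j.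
Proof.
rewrite /bad/= => /negP; rewrite -ltNge => /ltW.
have p2 : 0 < 2 ^+ j :> R by rewrite exprn_gt0.
have -> : k%:R + i.+1%:R / 2 ^+ j - (k%:R + i%:R / 2 ^+ j) = (2 ^+ j)^-1 :> R.
  by rewrite -natr1; field; rewrite gt_eqF.
by rewrite -mulrA -sqrtrM ?(ltW p2)// divff ?gt_eqF// sqrtr1 mulr1.
Qed.

(** Since [2 (3/4)^2 = 9/8] exceeds 1, Bernoulli's inequality makes the Gaussian exponent
    [32 (n+1)^2 (9/8)^j] at least [4 (n + j)], and [expR (- 1) <= 1 / 2]. *)
Let pr_bad n j k i : pr (bad n j k i) <= 2 * (16^-1) ^+ (n + j).
Proof.
have p2 : 0 < 2 ^+ j :> R by rewrite exprn_gt0.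
have t0 : 0 <= k%:R + i%:R / 2 ^+ j :> R by rewrite addr_ge0// divr_ge0// ltW.
have tt : k%:R + i%:R / 2 ^+ j < k%:R + i.+1%:R / 2 ^+ j :> R.
  by rewrite ltrD2l ltr_pM2r ?invr_gt0// ltr_nat.
have a0 : 0 <= 8 * n.+1%:R * (3 / 4) ^+ j * Num.sqrt (2 ^+ j) :> R.
  by rewrite !mulr_ge0// exprn_ge0// divr_ge0.
rewrite (le_trans (pr_incr_tail BM t0 tt a0))//.
rewrite ler_pM2l//.
have le_exp : expR (- (1 : R)) <= 2^-1.
  rewrite expRN lef_pV2 ?posrE ?expR_gt0//; have := expR_ge1Dx (1 : R); lra.
have -> : (16^-1 : R) ^+ (n + j) = 2^-1 ^+ (4 * (n + j)).
  by rewrite exprM; congr (_ ^+ _); rewrite !exprS expr0; field.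
apply: (@le_trans _ _ (expR (- (1 : R)) ^+ (4 * (n + j)))); last first.
  by rewrite lerXn2r ?nnegrE ?expR_ge0.
rewrite -expRM_natl ler_expR mulrN1 lerN2.
have -> : (8 * n.+1%:R * (3 / 4) ^+ j * Num.sqrt (2 ^+ j)) ^+ 2 / 2 =
    32 * n.+1%:R ^+ 2 * (9 / 8 : R) ^+ j.
  rewrite exprMn sqr_sqrtr ?(ltW p2)// (exprMn _ (_ * _)) -exprM mulnC exprM.
  rewrite -mulrA -mulrA -[(9 / 8)]/(9 / 8 : R).
  have -> : (9 / 8 : R) ^+ j = ((3 / 4) ^+ 2) ^+ j * 2 ^+ j.
    by rewrite -exprMn; congr (_ ^+ _); field.
  by field.
have bern : 1 + j%:R / 8 <= (9 / 8 : R) ^+ j.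
  elim: (j) => [|m ih]; first by rewrite mul0r addr0 expr0.
  rewrite exprS -natr1; have := ler0n R m; nra.
rewrite natrM natrD.
have N1 : 1 <= n.+1%:R :> R by rewrite ler1n.
have nN : n%:R = n.+1%:R - 1 :> R by rewrite -natr1 addrK.
have j0 := ler0n R j.
apply: (@le_trans _ _ (32 * n.+1%:R ^+ 2 * (1 + j%:R / 8))).
  have N2 : n.+1%:R <= n.+1%:R ^+ 2 :> R by rewrite expr2 ler_peMl// (le_trans _ N1).
  have N3 : j%:R <= n.+1%:R ^+ 2 * j%:R :> R by rewrite ler_peMl// (le_trans N1).
  rewrite nN; lra.
by rewrite ler_pM2l// mulr_gt0// exprn_gt0// (lt_le_trans _ N1).
Qed.

(** Borel-Cantelli over [l = n + j]. At level [l] there are [(l + 1) 4^l <= 8^l] triples, each of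
    probability at most [2 / 16^l], which leaves [2 / 2^l]. *)
Lemma chaining_ae : {ae P, forall w, exists N, forall n j k i,
  (N <= n)%N -> (k < 2 ^ n)%N -> (i < 2 ^ j)%N ->
  `|incr B (k%:R + i%:R / 2 ^+ j) (k%:R + i.+1%:R / 2 ^+ j) w| <=
    8 * n.+1%:R * (3 / 4) ^+ j}.
Proof.
pose idx l := [seq (x, y) | x <- iota 0 l.+1, y <- [seq (k, i) | k <- iota 0 (2 ^ l), i <- iota 0 (2 ^ l)]].
pose F l (x : nat * (nat * nat)) := bad x.1 (l - x.1) x.2.1 x.2.2.
pose G l := \bigcup_(x in [set` idx l]) F l x.
have mF l x : measurable (F l x).
  have t0 (a b c : nat) : 0 <= a%:R + b%:R / 2 ^+ c :> R.
    by rewrite addr_ge0// divr_ge0// exprn_ge0.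
  by apply: (measurable_incr BM (t0 _ _ _) (t0 _ _ _)); exact: measurable_tail.
have mG l : measurable (G l) by apply: fin_bigcup_measurable => //; exact: finite_seq.
have q01 : 0 <= (2^-1 : R) < 1 by lra.
apply: filterS (@borel_cantelli _ _ _ P G 2 2^-1 mG q01 _) => [w [N hN]|l].
  exists N => n j k i Nn kn ij; apply: badE => b.
  apply: (hN (n + j)%N); first exact: leq_trans Nn (leq_addr _ _).
  exists (n, (k, i)); last by rewrite /F/= addKn.
  apply/allpairsP; exists (n, (k, i)); split => //.
    by rewrite mem_iota add0n ltnS /= leq_addr.
  apply/allpairsP; exists (k, i); split => //; rewrite mem_iota add0n /=.
    by rewrite (leq_trans kn)// leq_exp2l// leq_addr.
  by rewrite (leq_trans ij)// leq_exp2l// leq_addl.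
rewrite (le_trans (pr_sub_bigU P (t := idx l) (mG l) (mF l) _))//.
  by move=> w [x /= xl Fx]; apply/hasP; exists x => //; exact/asboolP.
apply: (@le_trans _ _ (\sum_(x <- idx l) 2 * (16^-1) ^+ l)).
  rewrite big_seq [leRHS]big_seq; apply: ler_sum => x /allpairsP[[n y] [+ _ ->]].
  rewrite mem_iota add0n ltnS /= => nl.
  by rewrite (le_trans (pr_bad _ _ _ _))//= subnKC.
rewrite big_const_seq count_predT iter_addr_0 -[leLHS]mulr_natr -mulrA ler_pM2l//.
rewrite !size_allpairs !size_iota.
rewrite exprVn ler_pdivrMl ?exprn_gt0// -exprMn.
rewrite (_ : 16 / 2 = 8 :> R); last by field.
rewrite -natrX ler_nat (_ : 8 ^ l = 2 ^ l * (2 ^ l * 2 ^ l))%N; last by rewrite -!expnMn.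
by rewrite leq_mul// ltn_expl.
Qed.

End oscillation.

(** * Upper bound *)

Section upper_bound.
Context {R : realType} {d : measure_display} {T : measurableType d}.
Variables (P : probability T R) (B : R -> T -> R).
Hypothesis BM : standard_BM P B.
Local Notation pr := (pr P).

(** 33 is 32 + 1: the oscillation is at most [4 * (8 * n.+1%:R)], and one more [n.+1%:R] is reserved
    for the level [x]. *)
Let near0 (n k : nat) : set T := incr B 0 k%:R @^-1` `[- (33 * n.+1%:R), 33 * n.+1%:R].
Let shell n := iota (2 ^ n.-1) (2 ^ n.-1).

Let measurable_near0 n k : measurable (near0 n k).
Proof. exact: (measurable_incr BM). Qed.

Let mem_shell n k : (0 < n)%N -> (k \in shell n) = (2 ^ n.-1 <= k < 2 ^ n)%N.
Proof. by case: n => // n _; rewrite mem_iota/= addnn -mul2n -expnS. Qed.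

Lemma natrS_le_exp (b : R) n : 1 < b -> n.+1%:R <= (1 + (b - 1)^-1) * b ^+ n.
Proof.
move=> b1; have b0 : 0 < b - 1 by rewrite subr_gt0.
have bern : 1 + n%:R * (b - 1) <= b ^+ n.
  elim: n => [|n ih]; first by rewrite mul0r addr0 expr0.
  rewrite exprS -natr1; apply: (@le_trans _ _ (b * (1 + n%:R * (b - 1)))).
    have := mulr_ge0 (ler0n R n) (sqr_ge0 (b - 1)); lra.
  by rewrite ler_pM2l// (lt_trans _ b1).
have i0 : 0 < (b - 1)^-1 by rewrite invr_gt0.
apply: (@le_trans _ _ ((1 + (b - 1)^-1) * (1 + n%:R * (b - 1)))).
  rewrite (_ : _ * _ = n.+1%:R + ((b - 1)^-1 + n%:R * (b - 1))); last first.
    by rewrite -natr1; field; rewrite gt_eqF.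
  by rewrite lerDl addr_ge0 ?mulr_ge0// ltW.
by rewrite ler_pM2l// addr_gt0.
Qed.

(** Summing interval probabilities, the expected count is at most [66 (n+1)] times the [n]-th power
    of the square root of 2. In Markov's inequality one factor [b ^+ n] of the threshold absorbs
    [n + 1]; the other gives a summable bound. *)
Lemma count_near0_ae (b : R) : 1 < b ->
  {ae P, forall w, exists N, forall n, (N <= n)%N ->
    \sum_(k <- shell n) \1_(near0 n k) w <= (Num.sqrt 2 * b ^+ 2) ^+ n :> R}.
Proof.
move=> b1; have b0 : 0 < b by rewrite (lt_trans _ b1).
have a0 : 0 < Num.sqrt 2 :> R by rewrite sqrtr_gt0.
pose M n : R := (Num.sqrt 2 * b ^+ 2) ^+ n.
have M0 n : 0 < M n by rewrite exprn_gt0// mulr_gt0// exprn_gt0.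
pose f n w : R := \sum_(k <- shell n) \1_(near0 n k) w.
pose G n := f n @^-1` `[M n, +oo[%classic.
have mG n : measurable (G n).
  rewrite -[G n]setTI; apply: (_ : measurable_fun setT (f n)) => //.
  by apply: measurable_sum => k; exact: measurable_indic.
pose C := 66 * (1 + (b - 1)^-1).
have q01 : 0 <= b^-1 < 1 by rewrite invr_ge0 (ltW b0) invf_lt1.
apply: filterS (@borel_cantelli _ _ _ P G C b^-1 mG q01 _) => [w [N hN]|n].
  exists N => n /hN; rewrite /G/= in_itv/= andbT => /negP.
  by rewrite -ltNge => /ltW.
have markov : M n * pr (G n) <= \sum_(k <- shell n) 1 * pr (near0 n k).
  have := @simple_le _ _ _ P unit nat [:: tt] (shell n) (fun=> M n) (fun=> 1)
    (fun=> G n) (near0 n) (fun=> mG n) (measurable_near0 n).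
  rewrite big_seq1; apply => w; rewrite big_seq1.
  under eq_bigr do rewrite mul1r.
  have [Gw|nGw] := pselect (G n w); last first.
    rewrite indic0// mulr0; apply: sumr_ge0 => k _.
    by have /andP[] := @indic_01 R _ T (near0 n k) w.
  by rewrite indic1// mulr1; move: Gw; rewrite /G/= in_itv/= andbT.
have s0 : 0 < Num.sqrt (2 ^+ n.-1) :> R by rewrite sqrtr_gt0 exprn_gt0.
have sum_le : \sum_(k <- shell n) 1 * pr (near0 n k) <= 66 * n.+1%:R * Num.sqrt 2 ^+ n.
  apply: (@le_trans _ _ (\sum_(k <- shell n) 66 * n.+1%:R / Num.sqrt (2 ^+ n.-1))).
    rewrite big_seq [leRHS]big_seq; apply: ler_sum => k.
    rewrite mem_iota => /andP[nk _]; rewrite mul1r.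
    have k0 : 0 < k%:R :> R by rewrite ltr0n (leq_trans _ nk)// expn_gt0.
    rewrite (le_trans (pr_incr_itv_le BM _ k0 _))//.
      by rewrite ge0_cp// mulr_ge0.
    rewrite subr0 opprK (_ : _ + _ = 66 * n.+1%:R); last by ring.
    rewrite ler_wpM2l ?mulr_ge0// lef_pV2 ?posrE ?sqrtr_gt0//.
    by rewrite ler_wsqrtr// -natrX ler_nat.
  rewrite big_const_seq count_predT iter_addr_0 size_iota -[leLHS]mulr_natr natrX.
  rewrite -{2}(sqr_sqrtr (exprn_ge0 n.-1 (ler0n R 2))) -mulrA mulKf ?gt_eqF//.
  have -> m : Num.sqrt (2 ^+ m) = Num.sqrt 2 ^+ m :> R.
    by elim: m => [|m ih]; rewrite ?sqrtr1// !exprS sqrtrM ?ih.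
  rewrite ler_wpM2l ?mulr_ge0//.
  have step m : Num.sqrt 2 ^+ m.-1 <= Num.sqrt 2 ^+ m :> R.
    case: m => //= m; rewrite exprS ler_peMl ?exprn_ge0//.
    by rewrite -[leLHS]sqrtr1 ler_wsqrtr// ler1n.
  exact: step.
rewrite -(ler_pM2l (M0 n)) (le_trans markov)// (le_trans sum_le)//.
have := natrS_le_exp n b1; have sn : 0 < Num.sqrt 2 ^+ n :> R by rewrite exprn_gt0.
have -> : M n * (C * b^-1 ^+ n) = C * b ^+ n * Num.sqrt 2 ^+ n.
  rewrite /M exprMn -exprM mulnC exprM exprVn expr2.
  by field; rewrite gt_eqF ?exprn_gt0.
by rewrite /C => le_n; rewrite ler_pM2r// -mulrA ler_pM2l.
Qed.

Lemma nu_summable_ae : {ae P, forall w, forall (x rho : R), 1 / 2 < rho ->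
  (\sum_(1 <= n <oo) (nu n rho (level_set B w x))%:E < +oo)%E}.
Proof.
have [_ path _ _] := BM.
(* Countably many bases suffice, so the exceptional null set depends on neither [x] nor [rho]. *)
have count_ae : {ae P, forall w, forall m, exists N, forall n, (N <= n)%N ->
    \sum_(k <- shell n) \1_(near0 n k) w <= (Num.sqrt 2 * (1 + m.+1%:R^-1) ^+ 2) ^+ n :> R}.
  by apply: ae_foralln => m; apply: count_near0_ae; rewrite ltrDl invr_gt0.
have chain := chaining_ae BM.
apply: filterS2 path (filterI count_ae chain) => w [B0 cB] [count [N1 hN1]] x rho rho2.
have g1 : 0 < powR 2 rho / Num.sqrt 2 - 1 :> R.
  rewrite subr_gt0 ltr_pdivlMr ?sqrtr_gt0// mul1r -powR12_sqrt//.
  by rewrite /powR pnatr_eq0/= ltr_expR ltr_pM2r ?ln_gt0 ?ltr1n// -div1r.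
set g := powR 2 rho / Num.sqrt 2 in g1.
(* With [e = 1 / (m + 1) <= 1], [(1 + e)^2 <= 1 + 3 e < g], which is exactly what makes the ratio
   [q] below 1. *)
pose m := Num.truncn (3 / (g - 1)).
have bm : (1 + m.+1%:R^-1) ^+ 2 < g.
  have hm : 3 / (g - 1) < m.+1%:R := truncnS_gt _.
  have m1 : 1 <= m.+1%:R :> R by rewrite ler1n.
  have i1 : m.+1%:R^-1 <= 1 :> R by rewrite invf_le1 ?ltr0n.
  have i0 : 0 < m.+1%:R^-1 :> R by rewrite invr_gt0.
  have : 3 * m.+1%:R^-1 < g - 1.
    by rewrite ltr_pdivrMr ?ltr0n// -ltr_pdivrMl// mulrC.
  have : m.+1%:R^-1 * m.+1%:R^-1 <= m.+1%:R^-1 :> R by rewrite ler_piMl// ltW.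
  by rewrite expr2; move: (m.+1%:R^-1 : R) i0 i1 => z z0 z1 zz gz; lra.
have [N2 hN2] := count m.
pose q := Num.sqrt 2 * (1 + m.+1%:R^-1) ^+ 2 * powR 2 (- rho) : R.
have p0 : 0 < powR 2 rho :> R by rewrite powR_gt0.
have b0 : 0 < 1 + m.+1%:R^-1 :> R by rewrite addr_gt0// invr_gt0.
have q01 : 0 < q < 1.
  have c0 : 0 < Num.sqrt 2 * (1 + m.+1%:R^-1) ^+ 2 :> R.
    by rewrite mulr_gt0 ?sqrtr_gt0 ?exprn_gt0.
  rewrite /q powRN divr_gt0//= ltr_pdivrMr// mul1r mulrC.
  by rewrite -ltr_pdivlMr ?sqrtr_gt0.
(* Besides both random thresholds, [n] must exceed [|x|]. *)
apply: (@nu_summable _ _ _ 1 q (maxn 1 (maxn (maxn N1 N2) (Num.truncn `|x|).+1))) => // n.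
rewrite !geq_max => /andP[n1 /andP[/andP[nN1 nN2] nx]].
pose S := [seq k <- shell n | `[< near0 n k w >]].
apply: (@le_trans _ _ ((size S)%:R * powR (1 / 2 ^+ n) rho)).
  apply: nu_le_count => // [k|t [[t0 Bt] [t1 t2]]].
    by rewrite mem_filter mem_shell// => /andP[].
  pose k := Num.truncn t; have kt : k%:R <= t < k.+1%:R := truncn_itv t0.
  have kn : (2 ^ n.-1 <= k < 2 ^ n)%N.
    have /andP[k1 k2] := kt.
    rewrite -ltnS -(ltr_nat R) -[(k < _)%N](ltr_nat R) !natrX.
    by rewrite (le_lt_trans t1 k2) (le_lt_trans k1 t2).
  exists k; last exact/andP.
  rewrite mem_filter mem_shell// kn andbT; apply/asboolP.
  have osc : `|B t w - B k%:R w| <= 4 * (8 * n.+1%:R).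
    apply: (dyadic_chain (f := fun u => B u w) _ cB _ kt); first by rewrite mulr_ge0.
    move=> j i ij; apply: (hN1 n j k i) => //.
    by have /andP[] := kn.
  rewrite /near0/= in_itv/= /incr B0 subr0 -ler_norml.
  have xn : `|x| <= n.+1%:R.
    by rewrite (le_trans (ltW (truncnS_gt _)))// ler_nat (leq_trans nx).
  have -> : B k%:R w = x - (B t w - B k%:R w) by rewrite Bt opprB addrC subrK.
  rewrite (le_trans (ler_normB _ _))// (le_trans (lerD xn osc))//; lra.
have sizeS : (size S)%:R = \sum_(k <- shell n) \1_(near0 n k) w :> R.
  rewrite size_filter -sum1_count natr_sum big_mkcond/=; apply: eq_bigr => k _.
  have [h|h] := pselect (near0 n k w); first by rewrite indic1// asboolT.
  by rewrite indic0// asboolF.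
have e : powR (1 / 2 ^+ n) rho = powR 2 (- rho) ^+ n :> R.
  rewrite div1r -powR_invn// -powRrM -powR_mulrn ?powR_ge0// -powRrM.
  by congr powR; ring.
rewrite e mul1r /q exprMn ler_wpM2r ?exprn_ge0 ?powR_ge0//.
by rewrite sizeS; exact: hN2.
Qed.

End upper_bound.

(** * Crossings in one shell *)

Section power_sums.
Context {R : realType}.

(* Comparison with the integral of [x `^ (al - 1)], through
   [(1 - u) `^ al <= expR (- al * u) <= 1 - al * u / 2]. *)
Lemma sum_powR_le (al : R) (N : nat) : 0 < al <= 1 ->
  \sum_(0 <= i < N) powR i.+1%:R (al - 1) <= 2 / al * powR N%:R al.
Proof.
move=> /andP[al0 al1]; elim: N => [|N ih].
  by rewrite big_geq// mulr_ge0 ?powR_ge0// divr_ge0// ltW.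
rewrite big_nat_recr//=.
pose x : R := N.+1%:R; have x0 : 0 < x by rewrite ltr0n.
have i0 : 0 < x^-1 by rewrite invr_gt0.
have i1 : x^-1 <= 1 by rewrite invf_le1// ler1n.
suff key : powR N%:R al <= powR x al - al / 2 * powR x (al - 1).
  apply: (le_trans (lerD ih (lexx _))).
  rewrite -lerBrDr.
  apply: (@le_trans _ _ (2 / al * (powR x al - al / 2 * powR x (al - 1)))).
    by rewrite ler_wpM2l// divr_ge0// ltW.
  rewrite le_eqVlt; apply/orP; left; apply/eqP; rewrite -/x; field.
  by rewrite gt_eqF.
have -> : powR x (al - 1) = powR x al * x^-1.
  rewrite powRD; last by apply/implyP => _; rewrite gt_eqF.
  by rewrite powR_inv1// ltW.
have p0 : 0 < powR x al by rewrite powR_gt0.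
(* For [N = 0] the factor [1 - x^-1] vanishes and has no logarithm; the claim is then
   [0 <= 1 - al / 2]. *)
case: N {ih} @x x0 i0 i1 p0 => [|N] x x0 i0 i1 p0.
  rewrite powR0 ?gt_eqF// /x powR1 invr1; lra.
have u0 : 0 < 1 - x^-1 by rewrite subr_gt0 invf_lt1// ltr1n.
have -> : (N.+1%:R : R) = x * (1 - x^-1).
  by rewrite mulrBr mulr1 divff ?gt_eqF// /x -[in RHS]natr1 addrK.
rewrite powRM ?(ltW x0) ?(ltW u0)//.
apply: (@le_trans _ _ (powR x al * (1 - al / 2 * x^-1))); last first.
  by rewrite le_eqVlt; apply/orP; left; apply/eqP; ring.
rewrite ler_pM2l//.
set z := al * x^-1; have z0 : 0 < z by rewrite mulr_gt0.
have z1 : z <= 1 by rewrite mulr_ile1 ?(ltW al0) ?(ltW i0).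
rewrite (_ : al / 2 * x^-1 = z / 2); last by rewrite /z; ring.
apply: (@le_trans _ _ (expR (- z))).
  rewrite /powR gt_eqF// ler_expR /z -mulrN ler_pM2l//.
  by apply: le_ln1Dx; rewrite ltrN2 -subr_gt0.
have ez : expR (- z) * (1 + z) <= 1.
  by rewrite expRN ler_pdivrMl ?expR_gt0// mulr1 expR_ge1Dx.
have := expR_gt0 (- z); nra.
Qed.

(** Each positive distance occurs at most once on either side of [k], and [k] itself contributes
    once more at distance 1: three sums in all. *)
Lemma sum_dist_le (g : nat -> R) (k a b N : nat) : (forall i, 0 <= g i) ->
  (k < N)%N -> (a + b <= N)%N ->
  \sum_(l <- iota a b) g (maxn (maxn (k - l) (l - k)) 1) <=
    3 * \sum_(0 <= i < N) g i.+1.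
Proof.
move=> g0 kN abN.
pose D l := maxn (maxn (k - l) (l - k)) 1.
have mono (u v : nat) : (u <= v)%N ->
    \sum_(0 <= i < u) g i.+1 <= \sum_(0 <= i < v) g i.+1.
  move=> uv; rewrite [leRHS](big_cat_nat _ (n := u))//= lerDl.
  by apply: sumr_ge0.
have left : \sum_(0 <= l < k) g (D l) <= \sum_(0 <= i < N) g i.+1.
  rewrite big_nat_rev/= (le_trans _ (mono k N (ltnW kN)))//.
  rewrite !big_nat ler_sum// => i /= ik.
  by rewrite /D (_ : maxn _ 1 = i.+1)//; lia.
have right : \sum_(k <= l < N) g (D l) <= 2 * \sum_(0 <= i < N) g i.+1.
  rewrite -[k in \sum_(k <= _ < _) _]add0n big_addn.
  case Nk : (N - k)%N => [|u]; first by move: kN; rewrite -subn_gt0 Nk.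
  rewrite big_nat_recl// mulrDl !mul1r lerD//.
    have -> : D (0 + k) = 1%N by rewrite /D; lia.
    have := mono 1%N N (leq_ltn_trans (leq0n k) kN).
    by rewrite big_nat1.
  apply: (le_trans _ (mono u N _)); last by move: Nk kN; clear; lia.
  by apply: ler_sum => i _; rewrite /D (_ : maxn _ 1 = i.+1)//; lia.
have -> : iota a b = index_iota a (a + b) by rewrite /index_iota addKn.
have D0 (u v : nat) : 0 <= \sum_(u <= l < v) g (D l) by apply: sumr_ge0.
have all : \sum_(0 <= l < N) g (D l) <= 3 * \sum_(0 <= i < N) g i.+1.
  rewrite (big_cat_nat _ (n := k))//= ?(ltnW kN)//.
  by move: left right; move: (\sum_(0 <= i < N) g i.+1) => z; lra.
apply: le_trans all; rewrite [leRHS](big_cat_nat _ (n := a))//=; last first.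
  exact: leq_trans (leq_addr _ _) abN.
rewrite [X in _ <= _ + X](big_cat_nat _ (n := (a + b)%N)) ?leq_addr//=.
by rewrite addrCA lerDl addr_ge0.
Qed.

End power_sums.

Section block.
Context {R : realType} {d : measure_display} {T : measurableType d}.
Variables (P : probability T R) (B : R -> T -> R).
Hypothesis BM : standard_BM P B.
Local Notation pr := (pr P).

(** Here [y] stands for [j] minus the integer part of the position at time [s]. Rounding costs less
    than 1, so the path is below [j - 1] at [k] and at or above [j + 1] at [k.+1]. Windows on
    increments make independence applicable. *)
Definition crossing (s : nat) (y : R) (k : nat) : set T :=
  incr B s%:R k%:R @^-1` `[y - 3, y - 2] `&` incr B k%:R k.+1%:R @^-1` `[4, 5].

(** The last integer of the shell is left out, so that [[k, k+1]] stays inside the shell. *)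
Definition block (n : nat) := iota (2 ^ n.-1) (2 ^ n.-1).-1.

(* The diagonal carries the linear term [2 lam |S|], which makes [potential] a
   single combination of indicators of pairs of crossings. *)
Definition coef (n : nat) (rho lam : R) (p : nat * nat) : R :=
  (p.1 == p.2)%:R * (2 * lam) - lam ^+ 2 * riesz n rho p.1 p.2.

Definition potential (n : nat) (rho lam : R) (s : nat) (y : R) (w : T) : R :=
  \sum_(p <- [seq (k, l) | k <- block n, l <- block n])
     coef n rho lam p * \1_(crossing s y p.1 `&` crossing s y p.2) w.

Lemma measurable_crossing s y k : measurable (crossing s y k).
Proof. by apply: measurableI; exact: (measurable_incr BM). Qed.

Lemma potentialE n rho lam s y w :
  let S := [seq k <- block n | `[< crossing s y k w >]] in
  potential n rho lam s y w = 2 * lam * (size S)%:R - lam ^+ 2 * energy n rho S.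
Proof.
move=> S; rewrite /potential big_allpairs.
have indE k : \1_(crossing s y k) w = `[< crossing s y k w >]%:R :> R.
  have [h|h] := pselect (crossing s y k w); first by rewrite indic1// asboolT.
  by rewrite indic0// asboolF.
pose c k := `[< crossing s y k w >].
have e1 : 2 * lam * (size S)%:R = \sum_(k <- block n) 2 * lam * (c k)%:R.
  rewrite size_filter -sum1_count natr_sum big_mkcond mulr_sumr/=.
  by apply: eq_bigr => k _; rewrite -/(c k); case: (c k).
have e2 : lam ^+ 2 * energy n rho S = \sum_(k <- block n)
    lam ^+ 2 * ((c k)%:R * \sum_(l <- block n) (c l)%:R * riesz n rho k l).
  rewrite /energy big_filter big_mkcond mulr_sumr/=; apply: eq_bigr => k _.
  rewrite -/(c k); case: (c k); rewrite ?mul0r// mul1r big_filter big_mkcond/=.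
  congr (_ * _); apply: eq_bigr => l _.
  by rewrite -/(c l); case: (c l); rewrite ?mul0r ?mul1r.
rewrite e1 e2 -sumrB big_seq [RHS]big_seq; apply: eq_bigr => k kI.
transitivity (\sum_(l <- block n) ((k == l)%:R * (2 * lam * (c k)%:R)
   - lam ^+ 2 * ((c k)%:R * ((c l)%:R * riesz n rho k l)))).
  apply: eq_bigr => l _; rewrite /coef/= indic_setI !indE -/(c k) -/(c l) mulrBl.
  congr (_ - _); last by ring.
  have [<-|_] := eqVneq k l; last by rewrite !mul0r.
  by case: (c k); rewrite ?mulr1 ?mulr0 ?mul1r ?mul0r.
rewrite sumrB; congr (_ - _); last by rewrite -!mulr_sumr.
rewrite (bigD1_seq k) ?iota_uniq//= eqxx mul1r big1 ?addr0// => l.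
by rewrite eq_sym => /negbTE ->; rewrite mul0r.
Qed.

Lemma potential_le1 n rho lam s y w : 0 <= rho -> potential n rho lam s y w <= 1.
Proof.
move=> rho0; rewrite potentialE; apply: energy_le1 => // k.
rewrite mem_filter mem_iota => /andP[_ /andP[_ kn]].
case: n kn => [|n] /=; first by rewrite expn0.
by move=> kn; rewrite (leq_trans kn)// expnS mul2n -addnn leq_add2l leq_pred.
Qed.

Lemma measurable_potential n rho lam s y :
  measurable_fun setT (potential n rho lam s y).
Proof.
apply: measurable_sum => p; apply: measurable_funM => //.
by apply: measurable_indic; apply: measurableI; exact: measurable_crossing.
Qed.

End block.

(** * Moments of the potential given the past *)

Section block_probability.
Context {R : realType} {d : measure_display} {T : measurableType d}.
Variables (P : probability T R) (B : R -> T -> R).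
Hypothesis BM : standard_BM P B.
Local Notation pr := (pr P).
Variables (m s : nat) (y : R).
Hypotheses (m0 : (0 < m)%N) (s_le : (s <= 2 ^ (2 * m - 2))%N).
Let n := (2 * m)%N.
Let M : R := 2 ^+ m.

Let M0 : 0 < M. Proof. exact: exprn_gt0. Qed.

Let nE : n = (n - 2).+2.
Proof. by rewrite /n; move: m0; clear; lia. Qed.

Let exp_n : 2 ^+ n = M ^+ 2 :> R.
Proof. by rewrite /n mulnC exprM. Qed.

Let exp_n2 : 2 ^+ (n - 2) = (M / 2) ^+ 2 :> R.
Proof.
have : 2 ^+ n = 2 ^+ (n - 2) * 4 :> R by rewrite {1}nE !exprS; ring.
rewrite exp_n expr_div_n => ->; rewrite (_ : 2 ^+ 2 = 4 :> R); last by ring.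
by rewrite mulfK// pnatr_eq0.
Qed.

Let pred_exp : (2 ^ n.-1 = 2 ^ (n - 2) * 2)%N.
Proof. by rewrite {1}nE /= expnSr. Qed.

Let nat_exp : (2 ^ n = 2 ^ (n - 2) * 2 * 2)%N.
Proof. by rewrite {1}nE !expnSr. Qed.

Let exp_gt0 : (0 < 2 ^ (n - 2))%N. Proof. by rewrite expn_gt0. Qed.

Let block_range k : k \in block n -> (2 ^ (n - 2) * 2 <= k)%N /\ (k.+1 < 2 ^ n)%N.
Proof.
rewrite mem_iota pred_exp nat_exp; move: exp_gt0; clear.
by move: (2 ^ _)%N => z; lia.
Qed.

Let sk k : k \in block n -> (s < k)%N.
Proof.
move=> /block_range[k1 _]; move: s_le k1 exp_gt0; rewrite -/n; clear.
by move: (2 ^ (n - 2))%N => z; lia.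
Qed.

(** [s] is at most half of the first time of the shell, so the increment from [s] to [k] has
    standard deviation of order [M]. *)
Let sqrt_range k : k \in block n -> M / 2 <= Num.sqrt (k%:R - s%:R) <= M.
Proof.
move=> kI; have [k1 k2] := block_range kI.
have s0 := sk kI.
have sR : (s%:R : R) <= (M / 2) ^+ 2.
  by rewrite -exp_n2 -natrX ler_nat.
have kR : 2 * (M / 2) ^+ 2 <= k%:R by rewrite -exp_n2 -natrX -natrM ler_nat mulnC.
have kR' : (k%:R : R) <= M ^+ 2.
  by rewrite -exp_n -natrX ler_nat; apply: ltnW; apply: ltn_trans k2.
apply/andP; split.
  rewrite -[leLHS]ger0_norm ?divr_ge0 ?(ltW M0)// -sqrtr_sqr ler_wsqrtr//; lra.
rewrite -[leRHS]ger0_norm ?(ltW M0)// -sqrtr_sqr ler_wsqrtr//.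
by rewrite (le_trans _ kR')// lerBlDr lerDl.
Qed.

(** Two density bounds. The first window lies within [2 M + 3 <= 5 M], at most 10 standard
    deviations; the second within 5 standard deviations of a unit-time increment. *)
Definition crossing_const : R :=
  expR (- (10 ^+ 2 / 2)) / 3 * (expR (- (5 ^+ 2 / 2)) / 3).

Lemma pr_crossing_ge A k : past B s A -> k \in block n -> `|y| <= 2 * M ->
  pr A * (crossing_const / M) <= pr (A `&` crossing B s y k).
Proof.
move=> pA kI yM; have s_k := sk kI.
rewrite (past_independent BM _ (ltnSn k))// ler_wpM2l ?pr_ge0//.
have /andP[r1 r2] := sqrt_range kI.
have skR : (s%:R : R) < k%:R by rewrite ltr_nat.
have kkR : (k%:R : R) < k.+1%:R by rewrite ltr_nat.
have M1 : 1 <= M by rewrite -[leLHS](expr1n R m) lerXn2r ?nnegrE// ler1n.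
have q0 : 0 < Num.sqrt (k%:R - s%:R) :> R by rewrite (lt_le_trans _ r1)// divr_gt0.
have p1 : M^-1 * (expR (- (10 ^+ 2 / 2)) / 3) <= pr (incr B s%:R k%:R @^-1` `[y - 3, y - 2]).
  have y32 : y - 3 <= y - 2 by lra.
  have hM x : y - 3 <= x <= y - 2 -> `|x| <= 10 * Num.sqrt (k%:R - s%:R).
    move: yM; rewrite !ler_norml => /andP[? ?] /andP[? ?]; apply/andP; split; lra.
  apply: le_trans (pr_incr_itv_ge BM (ler0n R s) skR y32 hM).
  rewrite ler_wpM2r ?divr_ge0 ?expR_ge0//.
  by rewrite (_ : y - 2 - (y - 3) = 1) ?mul1r ?lef_pV2 ?posrE//; ring.
have p2 : expR (- (5 ^+ 2 / 2)) / 3 <= pr (incr B k%:R k.+1%:R @^-1` `[4, 5]).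
  have le45 : 4 <= 5 :> R by lra.
  have s1 : Num.sqrt (k.+1%:R - k%:R) = 1 :> R by rewrite -natr1 addrAC subrr add0r sqrtr1.
  have hM (x : R) : 4 <= x <= 5 -> `|x| <= 5 * Num.sqrt (k.+1%:R - k%:R).
    by move=> /andP[x4 x5]; rewrite s1 mulr1 ger0_norm// (le_trans _ x4).
  apply: le_trans (pr_incr_itv_ge BM (ler0n R k) kkR le45 hM).
  by rewrite s1 divr1 (_ : 5 - 4 = 1) ?mul1r//; ring.
have e1 := expR_ge0 (- (10 ^+ 2 / 2) : R); have e2 := expR_ge0 (- (5 ^+ 2 / 2) : R).
have h1 : 0 <= M^-1 * (expR (- (10 ^+ 2 / 2)) / 3).
  by rewrite mulr_ge0 ?invr_ge0 ?(ltW M0)// divr_ge0.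
have h2 : 0 <= expR (- (5 ^+ 2 / 2)) / 3 :> R by rewrite divr_ge0.
apply: le_trans (ler_pM h1 h2 p1 p2).
by rewrite le_eqVlt; apply/orP; left; apply/eqP; rewrite /crossing_const; ring.
Qed.

Let dist (k l : nat) := maxn (maxn (k - l) (l - k)) 1.

Let distC k l : dist k l = dist l k.
Proof. by rewrite /dist maxnC (maxnC (k - l)%N) maxnC. Qed.

(** For [k < l], both positions lie in one window of length 1, so the increment from [k] to [l] lies
    in [[-1, 1]]. It is independent of the increment up to [k], and the two factors are at most
    [2 / M] and 2 over the root of [l - k]. *)
Lemma pr_crossing2_le A k l : past B s A -> k \in block n -> l \in block n ->
  pr (A `&` (crossing B s y k `&` crossing B s y l)) <=
    pr A * (4 / M * powR (dist k l)%:R (- (1 / 2))).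
Proof.
wlog kl : k l / (k <= l)%N => [hw pA kI lI|pA kI lI].
  have [kl|lk] := leqP k l; first exact: hw.
  by rewrite setIC [_ `&` crossing _ _ _ _]setIC [in X in X <= _]setIC distC; apply: hw; rewrite // ltnW.
have mA := past_measurable BM pA.
have mC j := measurable_crossing BM s y j.
have /andP[r1 r2] := sqrt_range kI.
have skR : (s%:R : R) < k%:R by rewrite ltr_nat sk.
have q0 : 0 < Num.sqrt (k%:R - s%:R) :> R by rewrite (lt_le_trans _ r1)// divr_gt0.
have mI (a b : nat) (u v : R) : measurable (incr B a%:R b%:R @^-1` `[u, v]).
  exact: (measurable_incr BM).
have p1 : pr (incr B s%:R k%:R @^-1` `[y - 3, y - 2]) <= 2 / M.
  apply: (le_trans (pr_incr_itv_le BM (ler0n R s) skR _)); first lra.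
  rewrite (_ : y - 2 - (y - 3) = 1) ?mul1r; last by ring.
  by rewrite -[leRHS]invf_div lef_pV2 ?posrE ?divr_gt0.
move: kl; rewrite leq_eqVlt => /predU1P[<-|kl].
  rewrite setIid (_ : dist k k = 1%N) ?powR1; last by rewrite /dist subnn.
  apply: (@le_trans _ _ (pr (A `&` crossing B s y k))); first by [].
  rewrite (past_independent BM (sk kI) (ltnSn k))// ler_wpM2l ?pr_ge0//.
  apply: (@le_trans _ _ (2 / M * 1)); first by rewrite ler_pM ?pr_ge0// pr_le1.
  by rewrite !mulr1 ler_pM2r ?invr_gt0//; lra.
have klR : (k%:R : R) < l%:R by rewrite ltr_nat.
apply: (@le_trans _ _ (pr (A `&` (incr B s%:R k%:R @^-1` `[y - 3, y - 2] `&`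
    incr B k%:R l%:R @^-1` `[- 1, 1])))).
  apply: pr_mono; [by do !apply: measurableI|by do !apply: measurableI|].
  move=> w [Aw [[h1 _] [h2 _]]]; split=> //; split=> //.
  move: h1 h2; rewrite /= !in_itv/= /incr => /andP[? ?] /andP[? ?].
  by apply/andP; split; lra.
rewrite (past_independent BM (sk kI) kl)// ler_wpM2l ?pr_ge0//.
have -> : 4 / M * powR (dist k l)%:R (- (1 / 2)) = 2 / M * (2 / Num.sqrt (l%:R - k%:R)).
  have -> : dist k l = (l - k)%N by rewrite /dist; move: kl; clear; lia.
  by rewrite powRN div1r powR12_sqrt// natrB ?(ltnW kl)//; ring.
rewrite ler_pM ?pr_ge0//.
apply: (le_trans (pr_incr_itv_le BM (ler0n R k) klR _)); first lra.
by rewrite opprK.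
Qed.

Variable rho : R.
Hypothesis rho01 : 0 <= rho < 1 / 2.
Let al : R := 1 / 2 - rho.

Let al0 : 0 < al. Proof. by case/andP: rho01 => _; rewrite /al subr_gt0. Qed.
Let al1 : al <= 1. Proof. case/andP: rho01; rewrite /al; lra. Qed.

(** The powers of the distance combine to exponent [al - 1], and [al > 0] because [rho < 1 / 2]; the
    sum is thus of order [powR (2 ^+ n) al]. The prefactor [powR (2 ^+ n) rho] completes it to the
    square root of [2 ^+ n], that is [M]. *)
Let row_sum k : k \in block n ->
  \sum_(l <- block n) riesz n rho k l * powR (dist k l)%:R (- (1 / 2)) <= 6 / al * M.
Proof.
move=> /block_range[_ k2].
pose g i := powR i%:R (al - 1) : R.
have g0 i : 0 <= g i by exact: powR_ge0.
have eN l : riesz n rho k l * powR (dist k l)%:R (- (1 / 2)) =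
    powR (2 ^+ n) rho * g (dist k l).
  have D0 : 0 < (dist k l)%:R :> R by rewrite ltr0n leq_max orbT.
  rewrite /riesz -/(dist k l) powRM ?invr_ge0 ?exprn_ge0// (mulrC (powR _ _)) -mulrA.
  congr (_ * _); first by rewrite -powR_inv1 ?exprn_ge0// -powRrM mulrNN mul1r.
  rewrite -powRD; first by rewrite /g /al; congr powR; field.
  by apply/implyP => _; rewrite gt_eqF.
rewrite (eq_bigr _ (fun l _ => eN l)) -mulr_sumr.
have N_le : (2 ^ n.-1 + (2 ^ n.-1).-1 <= 2 ^ n)%N.
  by rewrite pred_exp nat_exp; move: (2 ^ _)%N exp_gt0; clear => z; lia.
have := sum_dist_le g0 (ltnW k2 : (k < _)%N) N_le.
rewrite -/(block n) => le3.
have al01 : 0 < al <= 1 by rewrite al0 al1.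
have := sum_powR_le (2 ^ n) al01 => leN.
apply: (@le_trans _ _ (powR (2 ^+ n) rho * (3 * (2 / al * powR (2 ^+ n) al)))).
  rewrite ler_wpM2l ?powR_ge0// (le_trans le3)// ler_wpM2l//.
  by rewrite (le_trans leN)// natrX.
have e : powR (2 ^+ n) rho * powR (2 ^+ n) al = M.
  rewrite -powRD; last by apply/implyP => _; rewrite gt_eqF// exprn_gt0.
  rewrite /al addrC subrK div1r powR12_sqrt ?exprn_ge0// exp_n sqrtr_sqr.
  by rewrite gtr0_norm.
rewrite le_eqVlt; apply/orP; left; apply/eqP; rewrite -e; ring.
Qed.

(** Each row gains at least [2 (lam/M) (crossing_const/M)] from the diagonal and loses at most
    [(lam/M)^2 (24/al)] to energy, both relative to [pr A]. The block has between [M^2 / 4] and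
    [M^2] rows. *)
Lemma potential_moment A lam : past B s A -> `|y| <= 2 * M -> 0 <= lam ->
  pr A * (lam * crossing_const / 2 - lam ^+ 2 * 24 / al) <=
  \sum_(p <- [seq (k, l) | k <- block n, l <- block n])
    coef n rho (lam / M) p * pr (A `&` (crossing B s y p.1 `&` crossing B s y p.2)).
Proof.
move=> pA yM lam0; rewrite big_allpairs.
have lM0 : 0 <= lam / M by rewrite divr_ge0// ltW.
have c0 : 0 <= crossing_const by rewrite mulr_ge0 ?divr_ge0 ?expR_ge0.
have A0 := pr_ge0 P A.
pose row := 2 * (lam / M) * (crossing_const / M) -
  (lam / M) ^+ 2 * (4 / M * (6 / al * M)) : R.
have step k : k \in block n -> pr A * row <= \sum_(l <- block n)
    coef n rho (lam / M) (k, l) * pr (A `&` (crossing B s y k `&` crossing B s y l)).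
  move=> kI.
  have -> : \sum_(l <- block n) coef n rho (lam / M) (k, l) *
      pr (A `&` (crossing B s y k `&` crossing B s y l)) =
    2 * (lam / M) * pr (A `&` crossing B s y k) - (lam / M) ^+ 2 *
      \sum_(l <- block n) riesz n rho k l *
        pr (A `&` (crossing B s y k `&` crossing B s y l)).
    rewrite mulr_sumr -[X in _ = X - _](_ : \sum_(l <- block n) (k == l)%:R *
        (2 * (lam / M) * pr (A `&` crossing B s y k)) = _); last first.
      rewrite (bigD1_seq k) ?iota_uniq//= eqxx mul1r big1 ?addr0// => l.
      by rewrite eq_sym => /negbTE ->; rewrite mul0r.
    rewrite -sumrB; apply: eq_bigr => l _; rewrite /coef/= mulrBl.
    congr (_ - _); last by ring.
    by have [<-|_] := eqVneq k l; rewrite ?mul0r// setIid !mul1r.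
  rewrite /row mulrBr lerB//.
    rewrite [leLHS](_ : _ = 2 * (lam / M) * (pr A * (crossing_const / M))).
      apply: ler_wpM2l; first by rewrite mulr_ge0.
      exact (pr_crossing_ge pA kI yM).
    by ring.
  rewrite mulrCA ler_wpM2l ?sqr_ge0//.
  apply: (@le_trans _ _ (\sum_(l <- block n) pr A * (4 / M) *
      (riesz n rho k l * powR (dist k l)%:R (- (1 / 2))))).
    rewrite big_seq [leRHS]big_seq; apply: ler_sum => l lI.
    rewrite [leRHS](_ : _ = riesz n rho k l * (pr A * (4 / M * powR (dist k l)%:R (- (1 / 2))))).
      by rewrite ler_wpM2l ?riesz_ge0//; exact: pr_crossing2_le.
    by ring.
  rewrite -mulr_sumr [leRHS]mulrA ler_wpM2l ?row_sum//.
  by rewrite mulr_ge0// divr_ge0// ltW.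
apply: (@le_trans _ _ (\sum_(k <- block n) pr A * row)); last first.
  by rewrite big_seq [leRHS]big_seq; apply: ler_sum => k; exact: step.
rewrite big_const_seq count_predT iter_addr_0 size_iota -[leRHS]mulr_natr -[leRHS]mulrA.
rewrite ler_wpM2l// /row.
set z : R := _%:R.
have z1 : M ^+ 2 / 4 <= z.
  have := exp_n2; rewrite expr_div_n (_ : 2 ^+ 2 = 4 :> R) => [<-|]; last by ring.
  rewrite -natrX ler_nat pred_exp; move: exp_gt0; clear.
  by move: (2 ^ (n - 2))%N => u; lia.
have z2 : z <= M ^+ 2.
  rewrite -exp_n -natrX ler_nat pred_exp nat_exp; clear.
  by move: (2 ^ (n - 2))%N => u; lia.
have -> : lam * crossing_const / 2 - lam ^+ 2 * 24 / al =
   2 * (lam / M) * (crossing_const / M) * (M ^+ 2 / 4) -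
   (lam / M) ^+ 2 * (4 / M * (6 / al * M)) * M ^+ 2.
  by field; rewrite !gt_eqF.
have cM0 : 0 <= crossing_const / M by rewrite divr_ge0// ltW.
have b0 : 0 <= 4 / M * (6 / al * M) by rewrite !mulr_ge0 ?invr_ge0// ltW.
have a0 : 0 <= 2 * (lam / M) by rewrite mulr_ge0.
rewrite mulrBl; apply: lerB; apply: ler_wpM2l => //; first exact: mulr_ge0.
by rewrite mulr_ge0 ?sqr_ge0.
Qed.

(** Half the maximum over [lam] of the quadratic in [potential_moment] with [al = a], attained at
    [lam = crossing_const * a / 96]. *)
Definition block_const (a : R) : R := crossing_const ^+ 2 * a / 768.

(** Reverse Markov inequality: the potential is at most 1 on [G] and at most [eta] off it, while its
    integral over [A] is at least [2 eta] times [pr A]. *)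
Lemma pr_potential_lt A : past B s A -> `|y| <= 2 * M ->
  pr (A `&` [set w | potential B n rho (crossing_const * al / 96 / M) s y w < block_const al])
    <= (1 - block_const al) * pr A.
Proof.
move=> pA yM; set lam := crossing_const * al / 96; set eta := block_const al.
have cc0 : 0 < crossing_const by rewrite mulr_gt0 ?divr_gt0 ?expR_gt0.
have lam0 : 0 <= lam by rewrite divr_ge0// mulr_ge0// ltW.
have eta0 : 0 <= eta.
  by apply: divr_ge0 (ler0n _ _); apply: mulr_ge0 (sqr_ge0 _) (ltW al0).
have := potential_moment pA yM lam0.
have -> : lam * crossing_const / 2 - lam ^+ 2 * 24 / al = 2 * eta.
  by rewrite /lam /eta /block_const; field; rewrite gt_eqF.
pose f := potential B n rho (lam / M) s y.
pose G := f @^-1` `[eta, +oo[%classic.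
have mG : measurable G.
  by rewrite -[G]setTI; apply: (measurable_potential BM n rho (lam / M) s y).
have mA := past_measurable BM pA.
have -> : A `&` [set w | f w < eta] = ~` G `&` A.
  rewrite setIC; congr (_ `&` _); apply/seteqP; split => w /=.
    by rewrite /G/= in_itv/= andbT => ?; apply/negP; rewrite -ltNge.
  by rewrite /G/= in_itv/= andbT => /negP; rewrite -ltNge.
rewrite pr_setCI// => mom.
have := @simple_le _ _ _ P _ bool [seq (k, l) | k <- block n, l <- block n] [:: true; false]
  (coef n rho (lam / M)) (fun b => if b then 1 else eta)
  (fun p => A `&` (crossing B s y p.1 `&` crossing B s y p.2))
  (fun b => if b then G `&` A else A).
rewrite !big_cons !big_nil !addr0 mul1r => le_pr.
suff : 2 * eta * pr A <= pr (G `&` A) + eta * pr A by lra.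
rewrite mulrC; apply: (le_trans mom); apply: le_pr.
- move=> p; apply: measurableI => //.
  by apply: measurableI; exact: (measurable_crossing BM).
- by case=> //; exact: measurableI.
move=> w; rewrite !big_cons !big_nil !addr0 mul1r.
have [Aw|nAw] := pselect (A w); last first.
  rewrite [X in _ <= _ + _ * X]indic0// (indic0 (A := G `&` A)); last by case.
  rewrite mulr0 addr0 big1// => p _; rewrite indic0 ?mulr0//; by case.
rewrite [X in _ <= _ + _ * X]indic1// mulr1 indic_setI (indic1 Aw) mulr1.
apply: (@le_trans _ _ (f w)).
  rewrite le_eqVlt; apply/orP; left; apply/eqP; apply: eq_bigr => p _.
  by rewrite indic_setI indic1// mul1r.
have [Gw|nGw] := pselect (G w).
  rewrite indic1// (le_trans (potential_le1 _ _ _ _ _ _ _))//; last by rewrite lerDl.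
  by case/andP: rho01.
rewrite indic0// add0r; move: nGw; rewrite /G/= in_itv/= andbT => /negP.
by rewrite -ltNge => /ltW.
Qed.

End block_probability.

(** * Successive shells *)

Section blocks.
Context {R : realType} {d : measure_display} {T : measurableType d}.
Variables (P : probability T R) (B : R -> T -> R).
Hypothesis BM : standard_BM P B.
Local Notation pr := (pr P).
Variables (rho j : R).
Hypothesis rho01 : 0 <= rho < 1 / 2.

(* Block [k] lives in the shell [n k] and ends at time [s k.+1], where the next
   one starts; [s k] is so small that [B (s k)] is typically below [2 ^ m k]. *)
Let m (k : nat) := (k.+1 ^ 2)%N.
Let s (k : nat) := (2 ^ (2 * k ^ 2))%N.
Let n (k : nat) := (2 * m k)%N.
Let M (k : nat) : R := 2 ^+ m k.
Let eta : R := block_const (1 / 2 - rho).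
Let lam (k : nat) : R := crossing_const * (1 / 2 - rho) / 96 / M k.

Let m_gt0 k : (0 < m k)%N. Proof. by rewrite expn_gt0. Qed.

Let s_le k : (s k <= 2 ^ (2 * m k - 2))%N.
Proof. by rewrite leq_exp2l// /m; clear; nia. Qed.

Let s_next k : s k.+1 = (2 ^ n k)%N. Proof. by []. Qed.

Let cc01 : 0 < (crossing_const : R) <= 1.
Proof.
have e1 (a : R) : 0 <= a -> expR (- a) / 3 <= 1.
  move=> a0; rewrite ler_pdivrMr// mul1r.
  by rewrite (@le_trans _ _ 1) ?ler1n// -[leRHS]expR0 ler_expR oppr_le0.
rewrite mulr_gt0 ?divr_gt0 ?expR_gt0//= mulr_ile1 ?divr_ge0 ?expR_ge0//.
  by apply: e1; rewrite divr_ge0// exprn_ge0.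
by apply: e1; rewrite divr_ge0// exprn_ge0.
Qed.

Let eta01 : 0 < eta <= 1.
Proof.
have /andP[c0 c1] := cc01; have /andP[r0 r1] := rho01.
have al0 : 0 < 1 / 2 - rho by rewrite subr_gt0.
have c2 : crossing_const ^+ 2 <= 1 :> R by rewrite expr_le1// ltW.
have al1 : 1 / 2 - rho <= 1 by lra.
have c3 : crossing_const ^+ 2 * (1 / 2 - rho) <= 1.
  by apply: mulr_ile1; rewrite ?sqr_ge0 ?(ltW al0).
have n0 : 0 < 768 :> R by rewrite ltr0n.
rewrite /eta /block_const; apply/andP; split.
  by apply: divr_gt0 n0; apply: mulr_gt0 al0; exact: exprn_gt0.
rewrite (ler_pdivrMr _ _ n0) [leRHS]mul1r; apply: (le_trans c3).
by rewrite ler1n.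
Qed.

(** Cutting the starting position into unit cells makes the offset [y] of the crossings
    deterministic on each cell. *)
Let start k l : set T := incr B 0 (s k)%:R @^-1` `[l%:R - M k, l.+1%:R - M k[.
Let low k l : set T :=
  [set w | potential B (n k) rho (lam k) (s k) (j - (l%:R - M k)) w < eta].
Let range k := iota 0 (2 * 2 ^ m k).
(** A start outside [[- M k, M k)] is no failure here; [small_start_ae] rules such starts out for
    large [k]. *)
Let fail k : set T := \bigcup_(l in [set` range k]) (start k l `&` low k l).

Let past_start k l : past B (s k) (start k l).
Proof. by rewrite /start -[0]/(0%:R); exact: past_incr. Qed.

(** All crossings of the block are decided by time [2 ^ n k], which is [s k.+1]. *)
Let past_low k l : past B (s k.+1) (low k l).
Proof.
have cross y i : i \in block (n k) -> past B (s k.+1) (crossing B (s k) y i).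
  rewrite mem_iota s_next => /andP[_ i_n].
  have nk : (2 ^ n k = 2 ^ (n k).-1 + 2 ^ (n k).-1)%N.
    by rewrite addnn -mul2n -expnS prednK// muln_gt0 m_gt0.
  have p0 : (0 < 2 ^ (n k).-1)%N by rewrite expn_gt0.
  have i1 : (i.+1 <= 2 ^ n k)%N.
    by move: i_n p0; rewrite nk; move: (2 ^ _)%N; clear => z; lia.
  have sk : (s k <= 2 ^ n k)%N by rewrite (leq_trans (s_le k))// leq_exp2l// leq_subr.
  by apply: pastI; apply: past_incr => //; exact: ltnW.
pose Tp := g_sigma_algebraType (cylinders B (s k.+1)).
pose f : Tp -> R := potential B (n k) rho (lam k) (s k) (j - (l%:R - M k)).
have mf : measurable_fun setT f.
  rewrite /f /potential.
  (* The guard makes every summand measurable for the past, including at pairs outside the block, as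
     [measurable_sum] asks. *)
  rewrite (_ : (fun w => _) = (fun w : Tp => \sum_(p <- [seq (a, b) | a <- block (n k), b <- block (n k)])
    if (p.1 \in block (n k)) && (p.2 \in block (n k)) then
      coef (n k) rho (lam k) p * \1_(crossing B (s k) (j - (l%:R - M k)) p.1 `&`
      crossing B (s k) (j - (l%:R - M k)) p.2) w else 0)); last first.
    apply/funext => w; rewrite /potential; apply: eq_big_seq.
    by move=> p /allpairsP[[a b] [/= aI bI ->]]; rewrite aI bI.
  apply: measurable_sum => p /=; set c := _ && _.
  case cE : c; last exact: measurable_cst.
  move/andP : cE => [p1 p2].
  apply: measurable_funM; first exact: measurable_cst.
  apply: measurable_indic; exact: pastI (cross _ _ p1) (cross _ _ p2).
have := mf measurableT _ (measurable_itv `]-oo, eta[).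
by rewrite setTI (_ : f @^-1` _ = low k l)//; apply/seteqP; split=> w /=; rewrite in_itv.
Qed.

Let past_fail k : past B (s k.+1) (fail k).
Proof.
rewrite /fail bigcup_mkcond; apply: past_bigcup => l.
have sk : (s k <= s k.+1)%N by rewrite s_next (leq_trans (s_le k))// leq_exp2l// leq_subr.
case: ifP => _.
  by apply: pastI; [apply: (past_mono sk); exact: past_start|exact: past_low].
by rewrite -setCT; apply: pastC; apply: pastT.
Qed.

Lemma sum_floor_le (z : R) N :
  \sum_(l <- iota 0 N) (l%:R <= z < l.+1%:R)%R%:R <= (z < N%:R)%R%:R :> R.
Proof.
elim: N => [|N ih]; first by rewrite big_nil ler0n.
rewrite -addn1 iotaD big_cat big_seq1/= add0n addn1 (le_trans (lerD ih (lexx _)))//.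
rewrite -natrD ler_nat leNgt.
have [zN|Nz] /= := ltP z N%:R; last by case: (z < _).
by rewrite (lt_le_trans zN) ?ler_nat.
Qed.

(** Apply [pr_potential_lt] on each starting cell, where [|y| <= |j| + M k <= 2 M k]. The cells are
    disjoint, so their probabilities within [A] add up to at most [pr A]. *)
Lemma pr_fail_le k A : past B (s k) A -> `|j| <= M k ->
  pr (A `&` fail k) <= (1 - eta) * pr A.
Proof.
move=> pA jM; have mA := past_measurable BM pA.
have mS l : measurable (start k l) := past_measurable BM (@past_start k l).
have mL l : measurable (low k l) := past_measurable BM (@past_low k l).
have mF : measurable (fail k) := past_measurable BM (@past_fail k).
have /andP[_ eta1] := eta01.
have M0 : 0 < M k by rewrite exprn_gt0.
apply: (@le_trans _ _ (\sum_(l <- range k) pr ((A `&` start k l) `&` low k l))).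
  apply: pr_sub_bigU; first exact: measurableI.
    by move=> l; do !apply: measurableI.
  by move=> w [Aw [l /= lr [sl ll]]]; apply/hasP; exists l => //; apply/asboolP.
apply: (@le_trans _ _ (\sum_(l <- range k) (1 - eta) * pr (A `&` start k l))).
  rewrite big_seq [leRHS]big_seq; apply: ler_sum => l.
  rewrite mem_iota add0n => /andP[_ lM].
  apply: (pr_potential_lt BM (m_gt0 k) (s_le k) rho01 (pastI pA (@past_start k l))).
  have l0 := ler0n R l.
  have l2 : l%:R <= 2 * M k by rewrite /M -natrX -natrM ler_nat ltnW.
  rewrite -/(M k) (le_trans (ler_normB _ _))//.
  have : `|l%:R - M k| <= M k by rewrite ler_norml; apply/andP; split; lra.
  lra.
rewrite -mulr_sumr ler_wpM2l ?subr_ge0//.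
have := @simple_le _ _ _ P nat unit (range k) [:: tt] (fun=> 1) (fun=> 1)
  (fun l => A `&` start k l) (fun=> A) (fun l => measurableI _ _ mA (mS l)) (fun=> mA).
rewrite big_seq1 mul1r; under eq_bigr do rewrite mul1r; apply=> w.
rewrite big_seq1 mul1r.
have [Aw|nAw] := pselect (A w); last first.
  by rewrite indic0// big1// => l _; rewrite indic0 ?mulr0//; case.
rewrite indic1//; apply: le_trans (_ : (incr B 0 (s k)%:R w + M k < (2 * 2 ^ m k)%:R)%R%:R <= _).
  apply: le_trans (sum_floor_le _ _); apply: ler_sum => l _.
  rewrite mul1r indic_setI indic1// mul1r.
  have [sl|nsl] := pselect (start k l w); last by rewrite indic0.
  rewrite indic1//; move: sl; rewrite /start/= in_itv/=.
  by rewrite lerBlDr ltrBrDr => ->.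
by rewrite lern1; case: (_ < _).
Qed.

Let all_fail K N : set T := \bigcap_(i in `I_N) fail (K + i).

Let all_failS K N : all_fail K N.+1 = all_fail K N `&` fail (K + N).
Proof.
apply/seteqP; split=> w.
  by move=> h; split=> [i /= iN|]; apply: h => //=; exact: ltnW.
by move=> [h1 h2] i /=; rewrite ltnS leq_eqVlt => /predU1P[->//|]; exact: h1.
Qed.

Let past_all_fail K N : past B (s (K + N)) (all_fail K N).
Proof.
elim: N => [|N ih]; first by rewrite /all_fail II0 bigcap_set0; exact: pastT.
rewrite all_failS addnS.
have sK : (s (K + N) <= s (K + N).+1)%N.
  by rewrite s_next (leq_trans (s_le _))// leq_exp2l// leq_subr.
by apply: pastI; [apply: (past_mono sK); exact: ih|exact: past_fail].
Qed.

Let pr_all_fail K N : `|j| <= M K -> pr (all_fail K N) <= (1 - eta) ^+ N.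
Proof.
move=> jM; have /andP[_ eta1] := eta01.
elim: N => [|N ih]; first by rewrite /all_fail II0 bigcap_set0 prT expr0.
rewrite all_failS exprS.
have jM' : `|j| <= M (K + N).
  by rewrite (le_trans jM)// /M ler_eXn2l ?ltr1n// leq_exp2r// ltnS leq_addr.
apply: (le_trans (pr_fail_le (@past_all_fail K N) jM')).
by apply: ler_wpM2l; rewrite ?subr_ge0.
Qed.

Lemma not_fail_ae : {ae P, forall w, forall N, exists2 k, (N <= k)%N & ~ fail k w}.
Proof.
apply: ae_foralln => N.
pose K := maxn N (Num.truncn `|j|).
(* Blocks before [K] may be too small to reach the level [j]; from [K] on, [pr_fail_le] applies. *)
have jK : `|j| <= M K.
  rewrite (le_trans (ltW (truncnS_gt _)))// /M -natrX ler_nat.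
  apply: (leq_trans (_ : _ <= K.+1)%N); first by rewrite ltnS leq_maxr.
  apply: leq_trans (ltnW (ltn_expl _ (ltnSn 1))) _; rewrite leq_exp2l// /m expnS.
  by rewrite leq_pmulr// expn_gt0.
have /andP[eta0 eta1] := eta01.
have q01 : 0 <= 1 - eta < 1 by rewrite subr_ge0 eta1 gtrBl.
have mG i : measurable (all_fail K i) := past_measurable BM (@past_all_fail K i).
apply: filterS (@ae_not_of_le_geometric _ _ _ P [set w | forall k, (N <= k)%N -> fail k w]
  (1 - eta) (all_fail K) mG q01 _ _).
- move=> w /= /existsNP[k /not_implyP[Nk nf]]; by exists k.
- by move=> i; exact: pr_all_fail.
- by move=> i w Fw l _; apply: Fw; exact: leq_trans (leq_maxl N _) (leq_addr _ _).
Qed.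

(** The increment has standard deviation [2^(k^2)], and [M k] exceeds it by the factor
    [2^((k+1)^2 - k^2) = 2^(2k+1)]; the Gaussian tails are summable. *)
Lemma small_start_ae : {ae P, forall w, exists N, forall k, (N <= k)%N ->
  `|incr B 0 (s k)%:R w| < M k}.
Proof.
pose F k := incr B 0 (s k)%:R @^-1` [set x | 2 ^+ k.*2.+1 * Num.sqrt ((s k)%:R - 0) <= `|x|].
have mF k : measurable (F k).
  by apply: (measurable_incr BM) => //; exact: measurable_tail.
have q01 : 0 <= (2^-1 : R) < 1 by lra.
apply: filterS (@borel_cantelli _ _ _ P F 2 2^-1 mF q01 _) => [w [N hN]|k].
  exists N => k /hN; rewrite /F/= => /negP; rewrite -ltNge.
  rewrite subr0 (_ : _ * _ = M k)// /s natrX mulnC exprM sqrtr_sqr.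
  rewrite ger0_norm ?exprn_ge0// -exprD /M /m; congr (_ ^+ _).
  by clear; nia.
have s0 : 0 < (s k)%:R :> R by rewrite ltr0n expn_gt0.
have a0 : 0 <= 2 ^+ k.*2.+1 :> R by rewrite exprn_ge0.
apply: (le_trans (pr_incr_tail BM (lexx 0) s0 a0)).
rewrite ler_pM2l//.
have le_exp : expR (- (1 : R)) <= 2^-1.
  rewrite expRN lef_pV2 ?posrE ?expR_gt0//; have := expR_ge1Dx (1 : R); lra.
apply: (@le_trans _ _ (expR (- (1 : R)) ^+ k)); last first.
  by rewrite lerXn2r ?nnegrE ?expR_ge0.
rewrite -expRM_natl ler_expR mulrN1 lerN2 ler_pdivlMr//.
rewrite -exprM -natrX -natrM ler_nat.
apply: (@leq_trans (2 ^ (k + 1))%N).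
  by rewrite expnD expn1 leq_mul2r/= ltnW// ltn_expl.
by rewrite leq_exp2l//; clear; lia.
Qed.

(** On a block that does not fail, the potential is at least [eta]. Each crossing time yields a zero
    of [B - x] in its unit interval, hence a covering interval met there, and [energy_le_cost]
    applies with one almost sure event for all [x] at once. *)
Lemma nu_ge_ae : {ae P, forall w, forall x : R, j <= x <= j + 1 ->
  forall N, exists2 i, (N < i)%N & eta / 2 <= nu i rho (level_set B w x)}.
Proof.
have [_ path _ _] := BM.
apply: filterS2 path (filterI not_fail_ae small_start_ae) => w [B0 cB].
move=> [often [N0 small]] x /andP[jx xj] N.
have [k] := often (maxn N N0); rewrite geq_max => /andP[Nk N0k] nf.
have n_gt : (k < n k)%N by rewrite /n /m; clear; nia.
have n0 : (0 < n k)%N by exact: leq_ltn_trans n_gt.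
exists (n k); first exact: leq_ltn_trans n_gt.
apply: le_nu => // Q [aQ cQ].
set z := incr B 0 (s k)%:R w; have zM := small k N0k; rewrite -/z in zM.
have z0 : 0 <= z + M k by move: zM; rewrite ltr_norml => /andP[]; lra.
pose l := Num.truncn (z + M k); have /andP[l1 l2] : l%:R <= z + M k < l.+1%:R := truncn_itv z0.
have eta_le : eta <= potential B (n k) rho (lam k) (s k) (j - (l%:R - M k)) w.
  rewrite leNgt; apply/negP => lw; apply: nf; exists l; last first.
    by split=> //; rewrite /start/= in_itv/= -/z; apply/andP; split; lra.
  rewrite /= mem_iota add0n /= -(ltr_nat R) natrM natrX -/(M k).
  by apply: (le_lt_trans l1); move: zM; rewrite ltr_norml => /andP[]; lra.
rewrite ler_pdivrMr// mulrC; apply: (le_trans eta_le); rewrite potentialE.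
apply: energy_le_cost => //.
  by case/andP: rho01 => -> ?; apply: ltW; lra.
move=> i; rewrite mem_filter => /andP[/asboolP[c1 c2] iI].
move: c1 c2; rewrite /= !in_itv/= /incr => /andP[a1 a2] /andP[b1 b2].
have zE : B (s k)%:R w = z by rewrite /z /incr B0 subr0.
have ii : (i%:R : R) <= i.+1%:R by rewrite ler_nat.
have cI : {within `[i%:R, i.+1%:R], continuous (fun t => B t w)}.
  apply: continuous_subspaceW cB => t /=; rewrite in_itv/= => /andP[it _].
  by rewrite (le_trans _ it).
rewrite -natr1 in l2.
(* The cell gives [j <= z + y < j + 1] for the offset [y], so [B i < j - 1] and [B i.+1 >= j + 1]
   enclose [x]. *)
have xI : Num.min (B i%:R w) (B i.+1%:R w) <= x <= Num.max (B i%:R w) (B i.+1%:R w).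
  by rewrite ge_min le_max; apply/andP; split; apply/orP; [left|right]; lra.
have [t] := IVT ii cI xI; rewrite in_itv/= => /andP[it ti] Btx.
have [q qQ tq] : exists2 q, q \in Q & int_interval q t.
  apply: cQ; split; first by split=> //; rewrite (le_trans _ it).
  move: iI; rewrite mem_iota => /andP[i1 i2]; split.
    by apply: le_trans it; rewrite -natrX ler_nat.
  apply: (le_lt_trans ti); rewrite -natrX ltr_nat.
  have nk : (2 ^ n k = 2 ^ (n k).-1 + 2 ^ (n k).-1)%N.
    by rewrite addnn -mul2n -expnS prednK.
  have p0 : (0 < 2 ^ (n k).-1)%N by rewrite expn_gt0.
  by move: i2 p0; rewrite nk; move: (2 ^ _)%N; clear => u; lia.
by exists q => //; exists t.
Qed.

End blocks.

(** * Passage to all levels and all exponents *)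

Lemma block_const_gt0 (R : realType) (a : R) : 0 < a -> 0 < block_const a.
Proof.
move=> a0; have n0 : 0 < 768 :> R by rewrite ltr0n.
apply: divr_gt0 n0; apply: mulr_gt0 a0; apply: exprn_gt0.
by apply: mulr_gt0; apply: divr_gt0; rewrite ?expR_gt0.
Qed.

Theorem theorem2 (R : realType) (d : measure_display) (T : measurableType d)
  (P : probability T R) (B : R -> T -> R) :
  standard_BM P B ->
  {ae P, forall w, forall x : R, macro_dimH (level_set B w x) = 1 / 2}.
Proof.
move=> BM.
(* Countably many exponents increasing to 1/2; the shift by 2 makes [r 0] equal to 0. *)
pose r (p : nat) : R := 1 / 2 - p.+2%:R^-1.
have r01 p : 0 <= r p < 1 / 2.
  rewrite /r subr_ge0 gtrBl invr_gt0 ltr0n andbT div1r.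
  by rewrite lef_pV2 ?posrE ?ltr0n// ler_nat.
(* The integers [j] are written [a - b], so that countable intersections over naturals suffice. *)
have lower : {ae P, forall w, forall p a b : nat, forall x : R,
    a%:R - b%:R <= x <= a%:R - b%:R + 1 -> forall N, exists2 i, (N < i)%N &
      block_const (1 / 2 - r p) / 2 <= nu i (r p) (level_set B w x)}.
  apply: ae_foralln => p; apply: ae_foralln => a; apply: ae_foralln => b.
  exact: (nu_ge_ae BM (a%:R - b%:R) (r01 p)).
apply: filterS2 (nu_summable_ae BM) lower => w above below x.
apply: macro_dimH_eq => [|rho|rho /andP[rho0 rho1]]; first by rewrite divr_ge0.
  exact: above.
have [a [b xab]] : exists a b : nat, (a%:R - b%:R : R) <= x <= a%:R - b%:R + 1.
  have [x0|x0] := leP 0 x.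
    exists (Num.truncn x), 0%N; rewrite subr0 natr1.
    by have /andP[-> /ltW ->] := truncn_itv x0.
  have /andP[h1 h2] : (Num.truncn (- x))%:R <= - x < (Num.truncn (- x)).+1%:R.
    by apply: truncn_itv; rewrite oppr_ge0 ltW.
  exists 0%N, (Num.truncn (- x)).+1; move: h2; rewrite -natr1 => h2.
  by apply/andP; split; lra.
have gap : 0 < 1 / 2 - rho by rewrite subr_gt0.
(* This makes [1 / (p + 2) <= 1 / 2 - rho]; the lower bound at [r p] then descends to [rho] by
   monotonicity. *)
pose p := Num.truncn (1 / 2 - rho)^-1.
have rho_r : rho <= r p.
  rewrite /r lerBrDr -lerBrDl invf_ple ?posrE ?ltr0n//.
  by rewrite (le_trans (ltW (truncnS_gt _)))// ler_nat.
have c0 : 0 < block_const (1 / 2 - r p) / 2.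
  rewrite divr_gt0// block_const_gt0// subr_gt0.
  by have /andP[] := r01 p.
apply: (nu_not_summable c0) => N; have [i Ni ci] := below p a b x xab N.
exists i => //; apply: (le_trans ci); apply: nu_mono rho_r.
exact: leq_ltn_trans Ni.
Qed.
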